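(* Let $k>0$, let $c>0$ be a constant background charge, and let $0<\epsilon<\frac{1}{2\sqrt{ck}}$ (strong relaxation). Consider the one-dimensional Euler-Poisson system with relaxation $$\rho_t+(\rho u)_x=0,\qquad u_t+uu_x=kE-\frac{u}{\epsilon},\qquad E_x=\rho-c,\qquad x\in\mathbb{R},\ t>0,$$ with initial data $(\rho,u)(x,0)=(\rho_0,u_0)(x)$. If at all points $\alpha\in\mathbb{R}$ $$u_0'(\alpha)>\min\left\{0,\ -\left(1-\frac{\rho_0(\alpha)}{c}\right)\left(\sqrt{\frac{1}{4\epsilon^2}-ck}+\frac{1}{2\epsilon}\right)\right\},$$ then the solution of the system is smooth for all time. In this case, $u(x,t)\to0$ and $\rho(x,t)\to c$ exponentially fast as $t\to\infty$.
   Context: Initial data: $\rho_0,u_0\in C^1(\mathbb{R})$, $\rho_0>0$. Standing assumptions: $\int_{-\infty}^\infty(\rho(\xi,t)-c)\,d\xi=0$, $\rho(\pm\infty,t)=c$, $u(\pm\infty,t)=0$, and $E(x,t)=\int_{-\infty}^x(\rho(\xi,t)-c)\,d\xi$. Characteristics: $\frac{d}{dt}x(\alpha,t)=u(x(\alpha,t),t)$, $x(\alpha,0)=\alpha$; limits as $t\to\infty$ are along characteristics. ''Smooth for all time'' means a classical solution for all $t\ge0$ with $\rho$ and $u_x$ finite along the characteristics.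
   Formalization: For merely C^1 data rho need not be differentiable, so global smoothness means u, E in C^1, rho continuous, mass law in integral form; it is classical if so for a short time or if u_0' is C^1 and tends to 0. Solutions have rho bounded and u→0 at infinity, locally uniformly in time. *)

(* Defs.v *)
From Stdlib Require Import Reals.
From Coquelicot Require Import Coquelicot.
Open Scope R_scope.

(* Functions of space and time are written [f x t]; time ranges over
   [0, T) with [T : Rbar], so that [T = p_infty] means "for all time". *)

Definition class_C1 (f : R -> R) : Prop :=
  forall x, ex_derive f x /\ continuous (Derive f) x.

Definition lim_both (f : R -> R) (l : R) : Prop :=
  is_lim f m_infty l /\ is_lim f p_infty l.

Definition continuous_on_strip (T : Rbar) (f : R -> R -> R) : Prop :=
  forall x t, 0 <= t -> Rbar_lt t T ->
    filterlim (fun p : R * R => f (fst p) (snd p))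
      (within (fun p : R * R => 0 <= snd p) (locally (x, t)))
      (locally (f x t)).

(* C^1 on R x [0,T), up to the boundary t = 0: values at negative times are
   irrelevant, so the time derivative is only taken at t > 0 and [ft] is its
   continuous extension to t = 0. *)
Definition C1_on_strip (T : Rbar) (f : R -> R -> R) : Prop :=
  continuous_on_strip T f /\
  exists fx ft : R -> R -> R,
    continuous_on_strip T fx /\ continuous_on_strip T ft /\
    (forall x t, 0 <= t -> Rbar_lt t T ->
       is_derive (fun y => f y t) x (fx x t)) /\
    (forall x t, 0 < t -> Rbar_lt t T ->
       is_derive (fun s => f x s) t (ft x t)).

(* Solutions on R x [0,T) with the regularity propagated by C^1 data: along a
   characteristic rho = rho0 / x_alpha, and x_alpha involves u0', so for u0
   merely C^1 the density is continuous but in general not differentiable.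
   Hence rho_t + (rho u)_x = 0 is required here as the conservation law over
   every interval [a,b]; [classical_solution] below adds the pointwise
   equation.  The condition u = 0 at infinity is taken uniformly on compact
   time intervals (otherwise characteristics may come from infinity in finite
   time); together with the local-in-time bound on rho it makes the solution
   unique. *)
Record ep_solution (k c eps : R) (rho0 u0 : R -> R) (T : Rbar)
    (rho u E : R -> R -> R) : Prop := {
  ep_rho_init : forall x, rho x 0 = rho0 x;
  ep_u_init : forall x, u x 0 = u0 x;
  ep_rho_cont : continuous_on_strip T rho;
  ep_u_C1 : C1_on_strip T u;
  ep_E_C1 : C1_on_strip T E;
  ep_mass : forall a b t, 0 < t -> Rbar_lt t T ->
    is_derive (fun s => RInt (fun x => rho x s) a b) t
      (rho a t * u a t - rho b t * u b t);
  ep_momentum : forall x t, 0 < t -> Rbar_lt t T ->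
    Derive (fun s => u x s) t + u x t * Derive (fun y => u y t) x
      = k * E x t - u x t / eps;
  ep_poisson : forall x t, 0 <= t -> Rbar_lt t T ->
    is_derive (fun y => E y t) x (rho x t - c);
  ep_E_integral : forall x t, 0 <= t -> Rbar_lt t T ->
    is_RInt_gen (fun y => rho y t - c)
      (Rbar_locally m_infty) (at_point x) (E x t);
  ep_neutral : forall t, 0 <= t -> Rbar_lt t T ->
    is_RInt_gen (fun y => rho y t - c)
      (Rbar_locally m_infty) (Rbar_locally p_infty) 0;
  ep_u_far : forall tau, 0 <= tau -> Rbar_lt tau T ->
    forall eta, 0 < eta -> exists M, forall x t,
      0 <= t <= tau -> M < Rabs x -> Rabs (u x t) < eta;
  ep_rho_bounded : forall tau, 0 <= tau -> Rbar_lt tau T ->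
    exists M, forall x t, 0 <= t <= tau -> Rabs (rho x t) <= M
}.

Record classical_solution (k c eps : R) (rho0 u0 : R -> R) (T : Rbar)
    (rho u E : R -> R -> R) : Prop := {
  cl_ep : ep_solution k c eps rho0 u0 T rho u E;
  cl_rho_C1 : C1_on_strip T rho;
  cl_mass : forall x t, 0 < t -> Rbar_lt t T ->
    Derive (fun s => rho x s) t + Derive (fun y => rho y t * u y t) x = 0;
  cl_rho_far : forall t, 0 <= t -> Rbar_lt t T ->
    lim_both (fun x => rho x t) c
}.

Definition characteristics (u : R -> R -> R) (X : R -> R -> R) : Prop :=
  forall alpha,
    X alpha 0 = alpha /\
    filterlim (X alpha) (at_right 0) (locally alpha) /\
    forall t, 0 < t -> is_derive (X alpha) t (u (X alpha t) t).

(* Main.v *)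
(* Along a characteristic x(t) the pair (u, E) solves the linear system
   u' = k E - u / eps, E' = - c u, whose eigenvalues are - mu1 and - mu2 with
   mu1, mu2 = 1 / (2 eps) -+ sqrt (1 / (4 eps^2) - c k) > 0, and c x + E is
   conserved.  Hence the flow map alpha -> x(alpha, t) is explicit, the
   threshold condition bounds its Jacobian below by min (1, rho0 / c), and the
   solution is read off its inverse.  The decay rate is mu1.
   Conversely the same invariants of the linear system, written for an
   arbitrary solution, satisfy a transport equation, and a maximum principle
   for that equation gives uniqueness.  Finally rho = rho0 / x_alpha is C^1 at
   one positive time if and only if u0' is. *)
Require Import Defs.
From Stdlib Require Import Reals Lra IndefiniteDescription.
From Coquelicot Require Import Coquelicot.
Open Scope R_scope.

(** * Continuity on a strip *)

(** The rate [mu2] enters the threshold because the Jacobian is [w + (1 - w) rho0 / c + q u0'],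
    where [w] and [q >= 0] are the fundamental solutions of the overdamped oscillator with rates
    [mu1], [mu2], and [w - mu2 q = exp (- mu2 t)]. A slope above [- (1 - rho0 / c) mu2] therefore
    leaves at least a convex combination of [1] and [rho0 / c]. The obstacle that shapes the
    construction is regularity: [rho] is only continuous in general. Derivatives of [E] are
    therefore taken through the conserved quantity, which involves the label alone, and the mass law
    over intervals is read off from [E]. For an arbitrary solution [E_t = - rho u] is not among the
    equations; it is recovered from the mass law, the conditions at infinity removing an unknown
    function of time. Characteristics of such a solution are never constructed: its label is an
    explicit combination of [x], [E] and the modes, so the comparison with the explicit solution
    takes place in Eulerian variables. *)

Lemma continuous_on_strip_epsilon (T : Rbar) (f : R -> R -> R) :
  continuous_on_strip T f <->
  forall x t, 0 <= t -> Rbar_lt t T -> forall eta, 0 < eta ->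
  exists delta, 0 < delta /\ forall x' t', Rabs (x' - x) < delta ->
    Rabs (t' - t) < delta -> 0 <= t' -> Rabs (f x' t' - f x t) < eta.
Proof.
split.
- intros H x t Ht HT eta He.
  destruct (proj1 (filterlim_locally _ _) (H x t Ht HT) (mkposreal _ He)) as [d Hd].
  exists d; split; [apply cond_pos|].
  intros x' t' hx ht h0; apply (Hd (x', t')); [split|]; assumption.
- intros H x t Ht HT; apply filterlim_locally; intros e.
  destruct (H x t Ht HT e (cond_pos e)) as [d [dp Hd]].
  exists (mkposreal d dp); intros [x' t'] [h1 h2] h0; apply Hd; assumption.
Qed.

Lemma continuous_on_strip_comp2 (T : Rbar) (h f g : R -> R -> R) :
  continuous_on_strip T f -> continuous_on_strip T g ->
  (forall x t, 0 <= t -> Rbar_lt t T ->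
     continuous (fun p : R * R => h (fst p) (snd p)) (f x t, g x t)) ->
  continuous_on_strip T (fun x t => h (f x t) (g x t)).
Proof.
intros Hf Hg Hh x t Ht HT.
refine (filterlim_comp _ _ _ (fun p : R * R => (f (fst p) (snd p), g (fst p) (snd p)))
  (fun p : R * R => h (fst p) (snd p)) _ (locally (f x t, g x t)) _ _ (Hh x t Ht HT)).
intros P [d Hd].
assert (Hf' := proj1 (filterlim_locally _ _) (Hf x t Ht HT) d).
assert (Hg' := proj1 (filterlim_locally _ _) (Hg x t Ht HT) d).
generalize (filter_and _ _ Hf' Hg'); unfold filtermap; apply filter_imp.
intros p [H1 H2]; apply Hd; split; assumption.
Qed.

Section ContinuityRules.

Context {U : UniformSpace}.
Implicit Types f g : U -> R.

Lemma continuous_Rplus f g x :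
  continuous f x -> continuous g x -> continuous (fun p => f p + g p) x.
Proof. intros; now apply (continuous_plus f g). Qed.

Lemma continuous_Ropp f x : continuous f x -> continuous (fun p => - f p) x.
Proof. intros; now apply (continuous_opp f). Qed.

Lemma continuous_Rminus f g x :
  continuous f x -> continuous g x -> continuous (fun p => f p - g p) x.
Proof. intros; now apply (continuous_minus f g). Qed.

Lemma continuous_Rmult f g x :
  continuous f x -> continuous g x -> continuous (fun p => f p * g p) x.
Proof. intros; now apply (continuous_mult f g). Qed.

Lemma continuous_Rinv_comp' f x :
  continuous f x -> f x <> 0 -> continuous (fun p => / f p) x.
Proof.
intros Hf Hx; apply (continuous_comp f Rinv); trivial.
now apply continuous_Rinv.
Qed.

Lemma continuous_Rdiv f g x :
  continuous f x -> continuous g x -> g x <> 0 ->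
  continuous (fun p => f p / g p) x.
Proof.
intros; apply continuous_Rmult; trivial; now apply continuous_Rinv_comp'.
Qed.

Lemma continuous_exp_comp f x : continuous f x -> continuous (fun p => exp (f p)) x.
Proof. intros Hf; apply (continuous_comp f exp); trivial; apply continuous_exp. Qed.

Lemma continuous_real_comp (h : R -> R) f x :
  continuous h (f x) -> continuous f x -> continuous (fun p => h (f p)) x.
Proof. intros; now apply (continuous_comp f h). Qed.

End ContinuityRules.

Ltac continuity_arith :=
  repeat lazymatch goal with
  | |- continuous (fun _ => ?a) _ => apply continuous_const
  | |- continuous fst _ => apply continuous_fst
  | |- continuous snd _ => apply continuous_snd
  | |- continuous (fun p => fst p) _ => apply continuous_fst
  | |- continuous (fun p => snd p) _ => apply continuous_snd
  | |- continuous (fun p => p) _ => apply continuous_id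
  | |- continuous (fun p => @?f p + @?g p) _ => apply (continuous_Rplus f g)
  | |- continuous (fun p => @?f p - @?g p) _ => apply (continuous_Rminus f g)
  | |- continuous (fun p => @?f p * @?g p) _ => apply (continuous_Rmult f g)
  | |- continuous (fun p => @?f p / @?g p) _ => apply (continuous_Rdiv f g)
  | |- continuous (fun p => - @?f p) _ => apply (continuous_Ropp f)
  | |- continuous (fun p => exp (@?f p)) _ => apply (continuous_exp_comp f)
  end.

Lemma is_derive_continuous (f : R -> R) x l : is_derive f x l -> continuous f x.
Proof. intros H; apply (ex_derive_continuous f x); now exists l. Qed.

Lemma continuous_on_strip_plus T f g :
  continuous_on_strip T f -> continuous_on_strip T g ->
  continuous_on_strip T (fun x t => f x t + g x t).
Proof.
intros Hf Hg; apply (continuous_on_strip_comp2 T Rplus); trivial.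
intros; apply continuous_Rplus; [apply continuous_fst|apply continuous_snd].
Qed.

Lemma continuous_on_strip_mult T f g :
  continuous_on_strip T f -> continuous_on_strip T g ->
  continuous_on_strip T (fun x t => f x t * g x t).
Proof.
intros Hf Hg; apply (continuous_on_strip_comp2 T Rmult); trivial.
intros; apply continuous_Rmult; [apply continuous_fst|apply continuous_snd].
Qed.

Lemma continuous_on_strip_continuous T (h : R -> R -> R) :
  (forall x t, 0 <= t -> Rbar_lt t T ->
     continuous (fun p : R * R => h (fst p) (snd p)) (x, t)) ->
  continuous_on_strip T h.
Proof.
intros H x t Ht HT; eapply filterlim_filter_le_1; [|exact (H x t Ht HT)].
intros P HP; unfold within; generalize HP; apply filter_imp; tauto.
Qed.

Lemma continuous_on_strip_const T a : continuous_on_strip T (fun _ _ => a).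
Proof. apply continuous_on_strip_continuous; intros; apply continuous_const. Qed.

Lemma continuous_on_strip_fst T : continuous_on_strip T (fun x _ => x).
Proof. apply continuous_on_strip_continuous; intros; apply continuous_fst. Qed.

Lemma continuous_on_strip_snd T : continuous_on_strip T (fun _ t => t).
Proof. apply continuous_on_strip_continuous; intros; apply continuous_snd. Qed.

Lemma continuous_on_strip_opp T f :
  continuous_on_strip T f -> continuous_on_strip T (fun x t => - f x t).
Proof.
intros Hf; apply (continuous_on_strip_comp2 T (fun a _ => - a) f f); trivial.
intros; apply continuous_Ropp, continuous_fst.
Qed.

Lemma continuous_on_strip_minus T f g :
  continuous_on_strip T f -> continuous_on_strip T g ->
  continuous_on_strip T (fun x t => f x t - g x t).
Proof.
intros Hf Hg; apply continuous_on_strip_plus; trivial.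
now apply continuous_on_strip_opp.
Qed.

Lemma continuous_on_strip_comp T (h : R -> R) f :
  (forall y, continuous h y) -> continuous_on_strip T f ->
  continuous_on_strip T (fun x t => h (f x t)).
Proof.
intros Hh Hf; apply (continuous_on_strip_comp2 T (fun a _ => h a) f f); trivial.
intros; apply (continuous_comp fst h); [apply continuous_fst|apply Hh].
Qed.

Lemma continuous_on_strip_slice T f t x :
  continuous_on_strip T f -> 0 <= t -> Rbar_lt t T -> continuous (fun y => f y t) x.
Proof.
intros Hf Ht HT; apply filterlim_locally; intros e.
destruct (proj1 (continuous_on_strip_epsilon T f) Hf x t Ht HT e (cond_pos e))
  as [d [dp Hd]].
exists (mkposreal d dp); intros y Hy; apply Hd; trivial.
rewrite Rminus_diag, Rabs_R0; trivial.
Qed.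

(** * Maximum principle for the transport equation *)

Lemma Rbar_lt_le_trans_real (T : Rbar) (s t : R) : s <= t -> Rbar_lt t T -> Rbar_lt s T.
Proof. intros H1 H2; exact (Rbar_le_lt_trans (Finite s) (Finite t) T H1 H2). Qed.

Lemma Rbar_lt_room (T : Rbar) (t : R) :
  Rbar_lt t T -> exists d, 0 < d /\ Rbar_lt (t + d) T.
Proof.
destruct T as [T| |]; simpl; intros H.
- exists ((T - t) / 2); simpl; lra.
- exists 1; simpl; split; [lra|trivial].
- contradiction.
Qed.

(** The maximum is taken in two stages, over [x] for each [t] and then over [t]. The chosen
    maximiser need not vary continuously with time, but the maximal value does, by uniform
    continuity on a rectangle. *)
Lemma continuous_on_strip_max (T : Rbar) (W : R -> R -> R) (M tau : R) :
  continuous_on_strip T W -> 0 <= M -> 0 <= tau -> Rbar_lt tau T ->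
  exists x0 t0, Rabs x0 <= M /\ 0 <= t0 <= tau /\
    forall x t, Rabs x <= M -> 0 <= t <= tau -> W x t <= W x0 t0.
Proof.
intros HW HM Htau HT.
(* Freezing time outside [[0, tau]] turns the one-sided continuity at [t = 0] into continuity on the
   whole plane. *)
pose (clamp := fun t => Rmax 0 (Rmin t tau)).
assert (clamp_range : forall t, 0 <= clamp t <= tau).
{ intros t; unfold clamp, Rmax, Rmin; repeat destruct Rle_dec; lra. }
assert (clamp_id : forall t, 0 <= t <= tau -> clamp t = t).
{ intros t; unfold clamp, Rmax, Rmin; repeat destruct Rle_dec; lra. }
assert (clamp_lip : forall s t, Rabs (clamp s - clamp t) <= Rabs (s - t)).
{ intros s t; unfold clamp, Rmax, Rmin, Rabs; repeat destruct Rle_dec;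
    repeat destruct Rcase_abs; lra. }
pose (f := fun x t => W x (clamp t)).
assert (Hf : forall x t, continuity_2d_pt f x t).
{ intros x t eta.
  destruct (proj1 (continuous_on_strip_epsilon T W) HW x (clamp t)
    (proj1 (clamp_range t)) (Rbar_lt_le_trans_real _ _ _ (proj2 (clamp_range t)) HT)
    eta (cond_pos eta)) as [d [dp Hd]].
  exists (mkposreal d dp); intros x' t' Hx' Ht'; apply Hd; trivial.
  - eapply Rle_lt_trans; [apply clamp_lip|exact Ht'].
  - apply clamp_range. }
assert (Hslice : forall t, exists x, Rabs x <= M /\
  forall y, Rabs y <= M -> f y t <= f x t).
{ intros t; destruct (continuity_ab_maj (fun x => f x t) (-M) M) as [x [H1 H2]].
  - lra.
  - intros x _; apply continuity_pt_locally; intros eta.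
    destruct (Hf x t eta) as [d Hd]; exists d; intros y Hy; apply Hd; trivial.
    rewrite Rminus_diag, Rabs_R0; apply cond_pos.
  - exists x; split; [now apply Rabs_le|].
    intros y Hy; apply H1; now apply Rabs_le_between. }
destruct (functional_choice _ Hslice) as [xm Hxm].
destruct (continuity_ab_maj (fun t => f (xm t) t) 0 tau Htau) as [t0 [H1 H2]].
{ intros t _; apply continuity_pt_locally; intros eta.
  destruct (uniform_continuity_2d f (-M) M (t - 1) (t + 1) (fun x y _ _ => Hf x y) eta)
    as [d Hd].
  exists (mkposreal _ (Rmin_pos d 1 (cond_pos d) Rlt_0_1)).
  intros s Hs; change (Rabs (s - t) < Rmin d 1) in Hs.
  assert (Hs1 := Rlt_le_trans _ _ _ Hs (Rmin_l d 1)).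
  assert (Hs2 := Rlt_le_trans _ _ _ Hs (Rmin_r d 1)).
  apply Rabs_def2 in Hs2.
  assert (Hu : forall x, Rabs x <= M -> Rabs (f x s - f x t) < eta).
  { intros x Hx; apply Rabs_le_between in Hx; apply Hd; try lra; trivial.
    rewrite Rminus_diag, Rabs_R0; apply cond_pos. }
  destruct (Hxm s) as [Is Ms]; destruct (Hxm t) as [It Mt].
  assert (A := Hu _ Is); assert (B := Hu _ It).
  apply Rabs_def2 in A; apply Rabs_def2 in B.
  specialize (Ms _ It); specialize (Mt _ Is).
  apply Rabs_def1; lra. }
exists (xm t0), t0; split; [apply Hxm|split; [exact H2|]].
intros x t Hx Ht.
assert (fW : forall y s, 0 <= s <= tau -> W y s = f y s).
{ intros y s Hs; unfold f; now rewrite clamp_id. }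
rewrite !fW by trivial.
eapply Rle_trans; [apply (Hxm t); exact Hx|now apply H1].
Qed.

(** Only arguments to the left are compared, because the maximum in the transport argument may sit
    at the final time [tau]. *)
Lemma is_derive_left_max (f : R -> R) (x l d : R) :
  is_derive f x l -> 0 < d -> (forall y, x - d < y <= x -> f y <= f x) -> 0 <= l.
Proof.
intros H dp Hmax; apply Rnot_lt_le; intros Hl.
apply is_derive_Reals in H.
destruct (H (- l / 2) ltac:(lra)) as [e He].
assert (ep := cond_pos e).
pose (h := - Rmin d e / 2).
assert (m1 := Rmin_l d e); assert (m2 := Rmin_r d e).
assert (m3 := Rmin_pos d e dp ep).
assert (A := He h ltac:(unfold h; lra) ltac:(apply Rabs_def1; unfold h; lra)).
assert (B := Hmax (x + h) ltac:(unfold h; lra)).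
apply Rabs_def2 in A; destruct A as [A _].
assert (C : (f (x + h) - f x) / h * h = f (x + h) - f x) by (field; unfold h; lra).
assert (hn : h < 0) by (unfold h; lra).
nra.
Qed.

Lemma is_derive_max (f : R -> R) (x l : R) :
  is_derive f x l -> (forall y, f y <= f x) -> l = 0.
Proof.
intros H Hmax; apply Rle_antisym.
- cut (0 <= - l); [lra|].
  apply (is_derive_left_max (fun y => f (- y)) (- x) (- l) 1); [|lra|].
  + replace (- l) with (scal (-1) l) by (unfold scal; simpl; unfold mult; simpl; ring).
    apply (is_derive_comp f Ropp (- x) l (-1)).
    * rewrite Ropp_involutive; exact H.
    * auto_derive; trivial; ring.
  + intros y _; rewrite Ropp_involutive; apply Hmax.
- now apply (is_derive_left_max f x l 1); [|lra|].
Qed.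

(* A positive value of [Z] would make [Z - delta t] attain, by the decay of [Z],
   a positive global maximum at some [t0 > 0]; there [Z_x = 0] and
   [Z_t >= delta], against the equation. *)
Lemma transport_nonpos (T : Rbar) (v Z Zx Zt : R -> R -> R) (tau : R) :
  0 <= tau -> Rbar_lt tau T -> continuous_on_strip T Z ->
  (forall x t, 0 < t <= tau -> is_derive (fun y => Z y t) x (Zx x t)) ->
  (forall x t, 0 < t <= tau -> is_derive (fun s => Z x s) t (Zt x t)) ->
  (forall x t, 0 < t <= tau -> Zt x t + v x t * Zx x t = 0) ->
  (forall x, Z x 0 = 0) ->
  (forall eta, 0 < eta -> exists M, forall x t,
     0 <= t <= tau -> M < Rabs x -> Rabs (Z x t) < eta) ->
  forall x t, 0 <= t <= tau -> Z x t <= 0.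
Proof.
intros Htau HT HZ Hx Ht Heq Hinit Hdec x1 t1 Ht1.
apply Rnot_lt_le; intros Hpos.
set (p := Z x1 t1) in Hpos.
(* The penalty costs at most [p / 2] up to time [t1]. Far points have values below [p / 4], so the
   maximum over a large box is a global one. *)
pose (delta := p / (2 * (t1 + 1))).
assert (dp : 0 < delta) by (unfold delta; apply Rdiv_lt_0_compat; lra).
assert (dt : delta * t1 <= p / 2).
{ replace (p / 2) with (delta * (t1 + 1)) by (unfold delta; field; lra).
  apply Rmult_le_compat_l; lra. }
destruct (Hdec (p / 4) ltac:(lra)) as [M HM].
pose (M' := Rmax M (Rabs x1)).
destruct (continuous_on_strip_max T (fun x t => Z x t - delta * t) M' tau)
  as (x0 & t0 & Hx0 & Ht0 & Hmax); trivial.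
{ apply continuous_on_strip_minus; trivial.
  apply continuous_on_strip_mult;
    [apply continuous_on_strip_const|apply continuous_on_strip_snd]. }
{ unfold M'; eapply Rle_trans; [apply Rabs_pos|apply Rmax_r]. }
simpl in Hmax.
assert (W0 : p / 2 <= Z x0 t0 - delta * t0).
{ eapply Rle_trans; [|apply (Hmax x1 t1); trivial; apply Rmax_r]; fold p; lra. }
assert (Hglob : forall x t, 0 <= t <= tau -> Z x t - delta * t <= Z x0 t0 - delta * t0).
{ intros x t Htt; destruct (Rle_lt_dec (Rabs x) M') as [h|h].
  - now apply Hmax.
  - assert (A := HM x t Htt (Rle_lt_trans _ _ _ (Rmax_l _ _) h)).
    apply Rabs_def2 in A; nra. }
assert (Ht0' : 0 < t0).
{ destruct (proj1 Ht0) as [h|h]; trivial.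
  subst t0; rewrite Hinit in W0; lra. }
assert (Zx0 : Zx x0 t0 = 0).
{ apply (is_derive_max (fun y => Z y t0) x0); [apply Hx; lra|].
  intros y; generalize (Hglob y t0 Ht0); lra. }
assert (Zt0 : 0 <= Zt x0 t0 - delta).
{ apply (is_derive_left_max (fun s => Z x0 s - delta * s) t0 _ t0); trivial.
  - apply (is_derive_minus (fun s => Z x0 s) (fun s => delta * s)).
    + apply Ht; lra.
    + auto_derive; trivial; ring.
  - intros y Hy; apply Hglob; lra. }
assert (A := Heq x0 t0 ltac:(lra)); rewrite Zx0 in A; lra.
Qed.

Lemma transport_zero (T : Rbar) (v Z Zx Zt : R -> R -> R) (tau : R) :
  0 <= tau -> Rbar_lt tau T -> continuous_on_strip T Z ->
  (forall x t, 0 < t <= tau -> is_derive (fun y => Z y t) x (Zx x t)) ->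
  (forall x t, 0 < t <= tau -> is_derive (fun s => Z x s) t (Zt x t)) ->
  (forall x t, 0 < t <= tau -> Zt x t + v x t * Zx x t = 0) ->
  (forall x, Z x 0 = 0) ->
  (forall eta, 0 < eta -> exists M, forall x t,
     0 <= t <= tau -> M < Rabs x -> Rabs (Z x t) < eta) ->
  forall x t, 0 <= t <= tau -> Z x t = 0.
Proof.
intros Htau HT HZ Hx Ht Heq Hinit Hdec x t Htt; apply Rle_antisym.
- now apply (transport_nonpos T v Z Zx Zt tau).
- cut (- Z x t <= 0); [lra|].
  apply (transport_nonpos T v (fun x t => - Z x t) (fun x t => - Zx x t)
    (fun x t => - Zt x t) tau); trivial.
  + now apply continuous_on_strip_opp.
  + intros y s Hs; apply (is_derive_opp (fun y => Z y s)); auto.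
  + intros y s Hs; apply (is_derive_opp (fun s => Z y s)); auto.
  + intros y s Hs; generalize (Heq y s Hs); lra.
  + intros y; rewrite Hinit; lra.
  + intros eta He; destruct (Hdec eta He) as [M HM]; exists M; intros y s Hs Hy.
    rewrite Rabs_Ropp; auto.
Qed.

(** * Limits at infinity and improper integrals *)

Lemma lim_both_epsilon (f : R -> R) (l : R) :
  lim_both f l <-> forall eta, 0 < eta -> exists M, forall x, M < Rabs x ->
    Rabs (f x - l) < eta.
Proof.
split.
- intros [Hm Hp] eta He.
  destruct (proj1 (filterlim_locally _ _) Hm (mkposreal _ He)) as [M1 H1].
  destruct (proj1 (filterlim_locally _ _) Hp (mkposreal _ He)) as [M2 H2].
  exists (Rmax (- M1) M2); intros x Hx.
  assert (A := Rmax_l (- M1) M2); assert (B := Rmax_r (- M1) M2).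
  unfold Rabs in Hx; destruct Rcase_abs in Hx.
  + apply H1; lra.
  + apply H2; lra.
- intros H; split; apply filterlim_locally; intros eta;
    destruct (H eta (cond_pos eta)) as [M HM].
  + exists (- Rabs M - 1); intros x Hx; apply HM.
    revert Hx; unfold Rabs; repeat destruct Rcase_abs; lra.
  + exists (Rabs M + 1); intros x Hx; apply HM.
    revert Hx; unfold Rabs; repeat destruct Rcase_abs; lra.
Qed.

Lemma lim_both_comp_proper (f g : R -> R) (l : R) :
  lim_both f l -> (forall A, exists M, forall x, M < Rabs x -> A < Rabs (g x)) ->
  lim_both (fun x => f (g x)) l.
Proof.
intros Hf Hg; apply lim_both_epsilon; intros eta He.
destruct (proj1 (lim_both_epsilon f l) Hf eta He) as [A HA].
destruct (Hg A) as [M HM]; exists M; auto.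
Qed.

Lemma lim_both_comp2 (h : R -> R -> R) (f g : R -> R) (a b : R) :
  lim_both f a -> lim_both g b ->
  continuous (fun p : R * R => h (fst p) (snd p)) (a, b) ->
  lim_both (fun x => h (f x) (g x)) (h a b).
Proof.
intros Hf Hg Hh; apply lim_both_epsilon; intros eta He.
destruct (proj1 (filterlim_locally _ _) Hh (mkposreal _ He)) as [d Hd].
destruct (proj1 (lim_both_epsilon f a) Hf d (cond_pos d)) as [M1 H1].
destruct (proj1 (lim_both_epsilon g b) Hg d (cond_pos d)) as [M2 H2].
exists (Rmax M1 M2); intros x Hx; apply (Hd (f x, g x)); split.
- apply H1; eapply Rle_lt_trans; [apply Rmax_l|exact Hx].
- apply H2; eapply Rle_lt_trans; [apply Rmax_r|exact Hx].
Qed.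

Lemma lim_both_bounded (f : R -> R) (l : R) :
  (forall x, continuous f x) -> lim_both f l ->
  exists B, forall x, Rabs (f x) <= B.
Proof.
intros Hc Hl.
destruct (proj1 (lim_both_epsilon f l) Hl 1 Rlt_0_1) as [M HM].
assert (HM0 := Rabs_pos M).
destruct (continuity_ab_maj (fun x => Rabs (f x)) (- Rabs M) (Rabs M)) as [x0 [H1 _]].
- lra.
- intros x _; apply continuity_pt_filterlim.
  apply (continuous_comp f Rabs); [apply Hc|apply continuous_Rabs].
- exists (Rmax (Rabs (f x0)) (Rabs l + 1)); intros x.
  destruct (Rle_lt_dec (Rabs x) (Rabs M)) as [h|h].
  + eapply Rle_trans; [apply H1, Rabs_le_between, h|apply Rmax_l].
  + eapply Rle_trans; [|apply Rmax_r].
    assert (A := HM x (Rle_lt_trans _ _ _ (Rle_abs M) h)).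
    replace (f x) with (l + (f x - l)) by ring.
    eapply Rle_trans; [apply Rabs_triang|lra].
Qed.

Section Antiderivative.

Variables (f g : R -> R).
Hypothesis g_derive : forall x, is_derive g x (f x).
Hypothesis f_cont : forall x, continuous f x.

Lemma is_RInt_antiderivative a b : is_RInt f a b (g b - g a).
Proof. apply (is_RInt_derive g f); auto. Qed.

Lemma is_RInt_antiderivative_eq a b y : is_RInt f a b y -> y = g b - g a.
Proof.
intros H; rewrite <- (is_RInt_unique _ _ _ _ H).
apply is_RInt_unique, is_RInt_antiderivative.
Qed.

Lemma is_RInt_gen_antiderivative_left (x L : R) :
  is_lim g m_infty L ->
  is_RInt_gen f (Rbar_locally m_infty) (at_point x) (g x - L).
Proof.
intros HL P [e He].
destruct (proj1 (filterlim_locally _ _) HL e) as [M HM].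
exists (fun a => a < M) (fun b => b = x).
- now exists M.
- reflexivity.
- intros a b Ha Hb; subst b; exists (g x - g a); split.
  + apply is_RInt_antiderivative.
  + apply He; assert (A := HM a Ha).
    change (Rabs (g x - g a - (g x - L)) < e); change (Rabs (g a - L) < e) in A.
    rewrite <- Rabs_Ropp; replace (- _) with (g a - L) by ring; exact A.
Qed.

Lemma is_RInt_gen_antiderivative_both (L : R) :
  lim_both g L ->
  is_RInt_gen f (Rbar_locally m_infty) (Rbar_locally p_infty) 0.
Proof.
intros [Hm Hp] P [e He].
pose (e2 := pos_div_2 e).
destruct (proj1 (filterlim_locally _ _) Hm e2) as [M1 H1].
destruct (proj1 (filterlim_locally _ _) Hp e2) as [M2 H2].
exists (fun a => a < M1) (fun b => M2 < b).
- now exists M1.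
- now exists M2.
- intros a b Ha Hb; exists (g b - g a); split.
  + now apply is_RInt_antiderivative.
  + apply He; assert (A := H1 a Ha); assert (B := H2 b Hb).
    change (Rabs (g b - g a - 0) < e).
    change (Rabs (g a - L) < e / 2) in A; change (Rabs (g b - L) < e / 2) in B.
    apply Rabs_def2 in A; apply Rabs_def2 in B; apply Rabs_def1; lra.
Qed.

Lemma is_RInt_gen_antiderivative_lim_left (x l : R) :
  is_RInt_gen f (Rbar_locally m_infty) (at_point x) l ->
  is_lim g m_infty (g x - l).
Proof.
intros H; apply filterlim_locally; intros e.
destruct (H (ball l e) (locally_ball l e)) as [Q S [M HM] HS HQS].
exists M; intros a Ha; destruct (HQS a x (HM a Ha) HS) as [y [H1 H2]].
simpl in H1; apply is_RInt_antiderivative_eq in H1; trivial; subst y.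
change (Rabs (g x - g a - l) < e) in H2; change (Rabs (g a - (g x - l)) < e).
rewrite <- Rabs_Ropp; replace (- _) with (g x - g a - l) by ring; exact H2.
Qed.

(** Two points near the left end are compared through one common point far to the right, which gives
    the Cauchy property. That the integral is 0 makes the right limit agree with the left one. *)
Lemma is_RInt_gen_antiderivative_lim_both :
  is_RInt_gen f (Rbar_locally m_infty) (Rbar_locally p_infty) 0 ->
  exists L : R, lim_both g L.
Proof.
intros H.
assert (Hc : forall e : posreal, exists M1 M2, forall a b, a < M1 -> M2 < b ->
  Rabs (g b - g a) < e).
{ intros e; destruct (H (ball 0 e) (locally_ball 0 e)) as [Q S [M1 H1] [M2 H2] HQS].
  exists M1, M2; intros a b Ha Hb.
  destruct (HQS a b (H1 a Ha) (H2 b Hb)) as [y [H3 H4]].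
  simpl in H3; apply is_RInt_antiderivative_eq in H3; trivial; subst y.
  change (Rabs (g b - g a - 0) < e) in H4; now rewrite Rminus_0_r in H4. }
destruct (proj1 (filterlim_locally_cauchy (F := Rbar_locally m_infty) g)) as [L HL].
{ intros e; destruct (Hc (pos_div_2 e)) as (M1 & M2 & HM).
  exists (fun a => a < M1); split; [now exists M1|].
  intros a a' Ha Ha'; change (Rabs (g a' - g a) < e).
  assert (A := HM a (M2 + 1) Ha ltac:(lra)); assert (B := HM a' (M2 + 1) Ha' ltac:(lra)).
  simpl in A, B; apply Rabs_def2 in A; apply Rabs_def2 in B; apply Rabs_def1; lra. }
exists L; split; trivial.
apply filterlim_locally; intros e.
destruct (Hc (pos_div_2 e)) as (M1 & M2 & HM).
destruct (proj1 (filterlim_locally _ _) HL (pos_div_2 e)) as [M3 H3].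
exists M2; intros b Hb.
pose (a := Rmin M1 M3 - 1).
assert (m1 := Rmin_l M1 M3); assert (m3 := Rmin_r M1 M3).
assert (A := HM a b ltac:(unfold a; lra) Hb); assert (B := H3 a ltac:(unfold a; lra)).
change (Rabs (g a - L) < e / 2) in B; change (Rabs (g b - L) < e); simpl in A.
apply Rabs_def2 in A; apply Rabs_def2 in B; apply Rabs_def1; lra.
Qed.

End Antiderivative.

(** * Differentiation along curves and implicit functions *)

Lemma differentiable_pt_lim_partials (f fx : R -> R -> R) (a t ft : R) :
  locally (a, t) (fun p => is_derive (fun z => f z (snd p)) (fst p) (fx (fst p) (snd p))) ->
  is_derive (fun s => f a s) t ft ->
  continuous (fun p : R * R => fx (fst p) (snd p)) (a, t) ->
  differentiable_pt_lim f a t (fx a t) ft.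
Proof.
intros H1 H2 H3; apply filterdiff_differentiable_pt_lim.
now apply is_derive_filterdiff.
Qed.

Lemma is_derive_comp_2d (f : R -> R -> R) (y z : R -> R) (s lx ly dy dz : R) :
  differentiable_pt_lim f (y s) (z s) lx ly ->
  is_derive y s dy -> is_derive z s dz ->
  is_derive (fun s => f (y s) (z s)) s (lx * dy + ly * dz).
Proof.
intros Hf Hy Hz; apply is_derive_Reals; apply derivable_pt_lim_comp_2d; trivial;
  now apply is_derive_Reals.
Qed.

Lemma is_derive_domin (f : R -> R) (s l : R) :
  is_derive f s l <-> forall eta : posreal,
    locally s (fun s' => Rabs (f s' - f s - (s' - s) * l) <= eta * Rabs (s' - s)).
Proof.
split.
- intros [_ H]; exact (H s (fun P HP => HP)).
- intros H; split; [apply is_linear_scal_l|].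
  intros s0 Hs0; rewrite <- (is_filter_lim_locally_unique _ _ Hs0); exact H.
Qed.

(** The expansion of [f] at the point bounds the error in [y] by a small multiple of the increment
    of [y] itself; as [lx <> 0], that part is absorbed on the left. Continuity of [y] brings the
    increments into the range where the expansion is valid. *)
Lemma is_derive_implicit (f : R -> R -> R) (y z h : R -> R) (s lx ly dz dh : R) :
  differentiable_pt_lim f (y s) (z s) lx ly -> lx <> 0 ->
  continuous y s -> is_derive z s dz -> is_derive h s dh ->
  locally s (fun s' => f (y s') (z s') = h s') ->
  is_derive y s ((dh - ly * dz) / lx).
Proof.
intros Hf Hlx Hy Hz Hh Heq.
assert (Hzc := is_derive_continuous _ _ _ Hz).
apply is_derive_domin; intros e.
set (D := (dh - ly * dz) / lx).
pose (K := Rabs D + Rabs dz + Rabs ly + 2).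
assert (hlx := Rabs_pos_lt _ Hlx).
assert (hD := Rabs_pos D); assert (hdz := Rabs_pos dz); assert (hly := Rabs_pos ly).
assert (hK : 0 < K) by (unfold K; lra).
assert (ep := cond_pos e).
pose (e0 := Rmin 1 (Rmin (Rabs lx / 2) (e * Rabs lx / (2 * K)))).
assert (e0p : 0 < e0).
{ unfold e0; repeat apply Rmin_pos; try lra.
  apply Rdiv_lt_0_compat; [now apply Rmult_lt_0_compat|lra]. }
assert (e01 : e0 <= 1) by apply Rmin_l.
assert (e02 : e0 <= Rabs lx / 2).
{ eapply Rle_trans; [apply Rmin_r|apply Rmin_l]. }
assert (e03 : e0 * K <= e * Rabs lx / 2).
{ replace (e * Rabs lx / 2) with (e * Rabs lx / (2 * K) * K) by (field; lra).
  apply Rmult_le_compat_r; [lra|]; eapply Rle_trans; [apply Rmin_r|apply Rmin_r]. }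
pose (e1 := mkposreal e0 e0p).
destruct (Hf e1) as [d Hd].
assert (Ny := proj1 (filterlim_locally _ _) Hy d).
assert (Nz := proj1 (filterlim_locally _ _) Hzc d).
assert (Nz' := proj1 (is_derive_domin z s dz) Hz e1).
assert (Nh := proj1 (is_derive_domin h s dh) Hh e1).
assert (Heq0 := locally_singleton _ _ Heq); simpl in Heq0.
generalize (filter_and _ _ (filter_and _ _ Ny Nz)
  (filter_and _ _ Heq (filter_and _ _ Nz' Nh))).
apply filter_imp; intros s' [[H1 H2] [H3 [H4 H5]]].
assert (H6 := Hd _ _ H1 H2); clear H1 H2.
rewrite H3, Heq0 in H6; simpl in H4, H5, H6.
set (u := y s' - y s) in *; set (w := z s' - z s) in *; set (q := s' - s) in *.
set (p := h s' - h s) in *.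
assert (hq := Rabs_pos q).
assert (B1 : Rabs w <= (Rabs dz + 1) * Rabs q).
{ replace w with ((w - q * dz) + q * dz) by ring.
  eapply Rle_trans; [apply Rabs_triang|]; rewrite Rabs_mult; nra. }
assert (B2 : Rmax (Rabs u) (Rabs w) <= Rabs u + Rabs w).
{ apply Rmax_lub; generalize (Rabs_pos u) (Rabs_pos w); lra. }
assert (B3 : Rabs u <= Rabs (u - q * D) + Rabs D * Rabs q).
{ replace u with ((u - q * D) + q * D) at 1 by ring.
  eapply Rle_trans; [apply Rabs_triang|]; rewrite Rabs_mult; lra. }
assert (B4 : Rabs lx * Rabs (u - q * D) <= e0 * Rmax (Rabs u) (Rabs w)
   + Rabs ly * (e0 * Rabs q) + e0 * Rabs q).
{ rewrite <- Rabs_mult.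
  replace (lx * (u - q * D)) with
    (- (p - (lx * u + ly * w)) + ((- ly) * (w - q * dz) + (p - q * dh)))
    by (unfold D; field; trivial).
  eapply Rle_trans; [apply Rabs_triang|]; rewrite Rabs_Ropp.
  rewrite Rplus_assoc; apply Rplus_le_compat; [exact H6|].
  eapply Rle_trans; [apply Rabs_triang|]; apply Rplus_le_compat; [|exact H5].
  rewrite Rabs_mult, Rabs_Ropp; apply Rmult_le_compat_l; [apply Rabs_pos|exact H4]. }
set (W := Rabs (u - q * D)) in *.
assert (hW : 0 <= W) by apply Rabs_pos.
assert (B5 : Rabs lx * W <= e0 * W + (e0 * K) * Rabs q).
{ eapply Rle_trans; [exact B4|].
  assert (e0 * Rmax (Rabs u) (Rabs w) <=
    e0 * (W + Rabs D * Rabs q + (Rabs dz + 1) * Rabs q)).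
  { apply Rmult_le_compat_l; lra. }
  unfold K; lra. }
assert (B6 : e0 * W <= Rabs lx / 2 * W) by now apply Rmult_le_compat_r.
assert (B7 : e0 * K * Rabs q <= e * Rabs lx / 2 * Rabs q) by now apply Rmult_le_compat_r.
apply (Rmult_le_reg_l (Rabs lx / 2)); lra.
Qed.

(* [auto_derive] leaves derivatives of eta-expanded functions. *)
Lemma Derive_eta (f : R -> R) (x l : R) : is_derive f x l -> Derive (fun y : R => f y) x = l.
Proof. apply is_derive_unique. Qed.

(** * Consequences of the equations for arbitrary solutions *)

(* Equations left by [is_derive] live in the carrier of a normed module. *)
Ltac real_eq := match goal with |- @eq _ ?a ?b => change (@eq R a b) end.

Section SolutionProperties.

Variables (k c eps : R) (rho0 u0 : R -> R) (T : Rbar) (rho u E : R -> R -> R).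
Hypothesis sol : ep_solution k c eps rho0 u0 T rho u E.

Let rho_slice t x : 0 <= t -> Rbar_lt t T -> continuous (fun y => rho y t - c) x.
Proof.
intros Ht HT; apply (continuous_Rminus (fun y => rho y t) (fun _ => c)).
- apply (continuous_on_strip_slice T); trivial; apply (ep_rho_cont _ _ _ _ _ _ _ _ _ sol).
- apply continuous_const.
Qed.

(** [E] is both an antiderivative of [rho - c] and its integral from the left end, so no additive
    constant is left over. *)
Lemma ep_solution_field_left t :
  0 <= t -> Rbar_lt t T -> is_lim (fun y => E y t) m_infty 0.
Proof.
intros Ht HT.
replace (Finite 0) with (Finite (E 0 t - E 0 t)) by (f_equal; ring).
apply (is_RInt_gen_antiderivative_lim_left (fun y => rho y t - c) (fun y => E y t)).
- intros y; now apply (ep_poisson _ _ _ _ _ _ _ _ _ sol).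
- intros y; now apply rho_slice.
- now apply (ep_E_integral _ _ _ _ _ _ _ _ _ sol).
Qed.

(** Neutrality forces equal limits at both ends. Time 0 suffices: later times are reached by
    integrating [E_t]. *)
Lemma ep_solution_field_right :
  Rbar_lt 0 T -> is_lim (fun y => E y 0) p_infty 0.
Proof.
intros HT.
assert (Hl := ep_solution_field_left 0 (Rle_refl 0) HT).
destruct (is_RInt_gen_antiderivative_lim_both (fun y => rho y 0 - c) (fun y => E y 0))
  as [L [Hm Hp]].
- intros y; apply (ep_poisson _ _ _ _ _ _ _ _ _ sol); trivial; lra.
- intros y; apply rho_slice; trivial; lra.
- apply (ep_neutral _ _ _ _ _ _ _ _ _ sol); trivial; lra.
- replace (Finite 0) with (Finite L); trivial.
  transitivity (Lim (fun y => E y 0) m_infty);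
    [symmetry|]; now apply is_lim_unique.
Qed.

Lemma ep_solution_flux_far tau eta :
  0 <= tau -> Rbar_lt tau T -> 0 < eta ->
  exists M, forall x t, 0 <= t <= tau -> M < Rabs x -> Rabs (rho x t * u x t) < eta.
Proof.
intros Htau HT He.
destruct (ep_rho_bounded _ _ _ _ _ _ _ _ _ sol tau Htau HT) as [B HB].
assert (hB := Rabs_pos B); assert (hB' := Rle_abs B).
destruct (ep_u_far _ _ _ _ _ _ _ _ _ sol tau Htau HT (eta / (Rabs B + 1)))
  as [M HM]; [apply Rdiv_lt_0_compat; lra|].
exists M; intros x t Ht Hx; rewrite Rabs_mult.
assert (A := HM x t Ht Hx); assert (C := HB x t Ht).
apply (Rmult_lt_compat_l (Rabs B + 1)) in A; [|lra].
replace ((Rabs B + 1) * (eta / (Rabs B + 1))) with eta in A by (field; lra).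
eapply Rle_lt_trans; [|exact A]; apply Rmult_le_compat_r; [apply Rabs_pos|lra].
Qed.

(* By the conservation law E_t + rho u is a function [h] of time alone; since
   E and rho u vanish at -oo, [h] has zero mean over every time interval. *)
Lemma ep_solution_field_time x t :
  0 < t -> Rbar_lt t T -> is_derive (fun s => E x s) t (- (rho x t * u x t)).
Proof.
intros Ht0 HT0.
destruct (ep_E_C1 _ _ _ _ _ _ _ _ _ sol) as [_ (Ex & Et & _ & Et_cont & _ & HEt)].
pose (h := fun s => Et 0 s + rho 0 s * u 0 s).
(* By the Poisson equation the mass over [[0, y]] is a difference of values of [E] plus [c * y]; its
   time derivative is compared with the flux difference of the mass law. *)
assert (Hh : forall y s, 0 < s -> Rbar_lt s T -> Et y s = h s - rho y s * u y s).
{ intros y s Hs HsT.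
  assert (Hint : forall s', 0 < s' -> Rbar_lt s' T ->
    RInt (fun z => rho z s') 0 y = E y s' + c * y - (E 0 s' + c * 0)).
  { intros s' Hs' HsT'; apply is_RInt_unique.
    apply (is_RInt_antiderivative (fun z => rho z s') (fun z => E z s' + c * z)).
    - intros z; replace (rho z s') with (rho z s' - c + c) by ring.
      apply (is_derive_plus (fun z => E z s') (fun z => c * z)).
      + apply (ep_poisson _ _ _ _ _ _ _ _ _ sol); trivial; lra.
      + auto_derive; trivial; ring.
    - intros z; apply (continuous_on_strip_slice T); trivial; [|lra].
      apply (ep_rho_cont _ _ _ _ _ _ _ _ _ sol). }
  assert (D1 := ep_mass _ _ _ _ _ _ _ _ _ sol 0 y s Hs HsT).
  assert (D2 : is_derive (fun s => RInt (fun z => rho z s) 0 y) s (Et y s - Et 0 s)).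
  { destruct (Rbar_lt_room T s HsT) as [d [dp Hd]].
    apply (is_derive_ext_loc (fun s' => (E y s' - E 0 s') + c * y)).
    - exists (mkposreal _ (Rmin_pos d s dp Hs)); intros s' Hs'.
      change (Rabs (s' - s) < Rmin d s) in Hs'.
      assert (A := Rlt_le_trans _ _ _ Hs' (Rmin_l d s)).
      assert (B := Rlt_le_trans _ _ _ Hs' (Rmin_r d s)).
      apply Rabs_def2 in A; apply Rabs_def2 in B.
      rewrite Hint; [real_eq; ring|lra|].
      apply (Rbar_lt_le_trans_real T s' (s + d)); trivial; lra.
    - replace (Et y s - Et 0 s) with (Et y s - Et 0 s + 0) by ring.
      apply (is_derive_plus (fun s' => E y s' - E 0 s') (fun _ => c * y)).
      + apply (is_derive_minus (fun s' => E y s') (fun s' => E 0 s')); auto.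
      + apply (is_derive_const (c * y)). }
  assert (A := is_derive_unique _ _ _ D1); rewrite (is_derive_unique _ _ _ D2) in A.
  unfold h; lra. }
cut (h t = 0).
{ intros H0; replace (- (rho x t * u x t)) with (Et x t); [now apply HEt|].
  rewrite Hh, H0; trivial; ring. }
apply Rabs_eq_0; apply Rle_antisym; [apply Rnot_lt_le; intros Hpos|apply Rabs_pos].
(* On [[t, t + b]] the function [h] stays within [p / 4] of [h t], and at the far point [y] the flux
   is below [p / 4]. Hence the mean slope of [E] at [y] exceeds [p / 2] in size, whereas end values
   below [b * p / 8] allow less than [p / 4]. *)
set (p := Rabs (h t)) in Hpos.
assert (h_cont : continuous_on_strip T (fun y s => Et y s + rho y s * u y s)).
{ apply continuous_on_strip_plus; trivial; apply continuous_on_strip_mult.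
  - apply (ep_rho_cont _ _ _ _ _ _ _ _ _ sol).
  - apply (ep_u_C1 _ _ _ _ _ _ _ _ _ sol). }
destruct (proj1 (continuous_on_strip_epsilon T _) h_cont 0 t (Rlt_le _ _ Ht0) HT0
  (p / 4) ltac:(lra)) as [d [dp Hd]].
destruct (Rbar_lt_room T t HT0) as [d' [dp' Hd']].
pose (b := Rmin (d / 2) d').
assert (bp : 0 < b) by (apply Rmin_pos; lra).
assert (b1 : b <= d / 2) by apply Rmin_l.
assert (b2 : b <= d') by apply Rmin_r.
assert (HbT : Rbar_lt (t + b) T) by (apply (Rbar_lt_le_trans_real T _ (t + d')); trivial; lra).
destruct (ep_solution_flux_far (t + b) (p / 4)) as [M HM]; trivial; try lra.
assert (ebp : 0 < b * p / 8) by (apply Rdiv_lt_0_compat; [apply Rmult_lt_0_compat; lra|lra]).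
assert (L1 := ep_solution_field_left t (Rlt_le _ _ Ht0) HT0).
assert (L2 := ep_solution_field_left (t + b) ltac:(lra) HbT).
destruct (proj1 (filterlim_locally _ _) L1 (mkposreal _ ebp)) as [M1 H1].
destruct (proj1 (filterlim_locally _ _) L2 (mkposreal _ ebp)) as [M2 H2].
pose (y := Rmin (- Rabs M) (Rmin M1 M2) - 1).
assert (y0 := Rmin_l (- Rabs M) (Rmin M1 M2)).
assert (y3 := Rmin_r (- Rabs M) (Rmin M1 M2)).
assert (y1 := Rmin_l M1 M2); assert (y2 := Rmin_r M1 M2).
assert (A1 := H1 y ltac:(unfold y; lra)); assert (A2 := H2 y ltac:(unfold y; lra)).
change (Rabs (E y t - 0) < b * p / 8) in A1.
change (Rabs (E y (t + b) - 0) < b * p / 8) in A2.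
destruct (MVT_gen (fun s => E y s) t (t + b) (fun s => Et y s)) as [s [Hs Heq]];
  rewrite ?Rmin_left, ?Rmax_right in * by lra.
{ intros s Hs; apply HEt; [lra|].
  apply (Rbar_lt_le_trans_real T _ (t + b)); trivial; lra. }
{ intros s Hs; apply continuity_pt_filterlim.
  apply (is_derive_continuous (fun s => E y s) s (Et y s)), HEt; [lra|].
  apply (Rbar_lt_le_trans_real T _ (t + b)); trivial; lra. }
rewrite Hh in Heq; [|lra|apply (Rbar_lt_le_trans_real T _ (t + b)); trivial; lra].
assert (A3 := HM y s ltac:(lra)
  ltac:(generalize (Rle_abs M) (Rabs_pos M); intros; rewrite Rabs_left; unfold y; lra)).
assert (A4 := Hd 0 s ltac:(rewrite Rminus_diag, Rabs_R0; trivial)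
  ltac:(rewrite Rabs_pos_eq; lra) ltac:(lra)).
change (Rabs (h s - h t) < p / 4) in A4.
apply Rabs_def2 in A1; apply Rabs_def2 in A2; apply Rabs_def2 in A3; apply Rabs_def2 in A4.
set (f := rho y s * u y s) in *.
unfold p, Rabs in *; destruct Rcase_abs; nra.
Qed.

(** Far out, [E] is small at time 0 and its time derivative, the flux up to sign, is uniformly
    small. Each contributes at most [eta / 2] up to time [tau]. *)
Lemma ep_solution_field_far tau eta :
  0 <= tau -> Rbar_lt tau T -> 0 < eta ->
  exists M, forall x t, 0 <= t <= tau -> M < Rabs x -> Rabs (E x t) < eta.
Proof.
intros Htau HT He.
assert (HT0 : Rbar_lt 0 T) by now apply (Rbar_lt_le_trans_real T 0 tau).
destruct (ep_solution_flux_far tau (eta / (2 * (tau + 1)))) as [M1 H1]; trivial.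
{ apply Rdiv_lt_0_compat; lra. }
assert (lim0 : lim_both (fun y => E y 0) 0).
{ split; [apply ep_solution_field_left; trivial; lra|now apply ep_solution_field_right]. }
destruct (proj1 (lim_both_epsilon _ _) lim0 (eta / 2) ltac:(lra)) as [M2 H2].
exists (Rmax M1 M2); intros x t Ht Hx.
assert (A2 := H2 x (Rle_lt_trans _ _ _ (Rmax_r _ _) Hx)); rewrite Rminus_0_r in A2.
destruct (Req_dec t 0) as [->|Hne]; [lra|].
assert (cont : continuous_on_strip T E) by apply (ep_E_C1 _ _ _ _ _ _ _ _ _ sol).
assert (B : Rabs (E x t - E x 0) <= eta / (2 * (tau + 1)) * t).
{ apply Rnot_lt_le; intros Hlt.
  (* [E_t] is known for positive times only, so the mean value theorem is used on [[s, t]]. By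
     continuity at time 0 the piece from 0 to [s] costs less than half of the supposed excess. *)
  pose (gap := (Rabs (E x t - E x 0) - eta / (2 * (tau + 1)) * t) / 2).
  destruct (proj1 (continuous_on_strip_epsilon T E) cont x 0 (Rle_refl 0) HT0 gap)
    as [d [dp Hd]]; [unfold gap; lra|].
  pose (s := Rmin (d / 2) (t / 2)).
  assert (sp : 0 < s) by (apply Rmin_pos; lra).
  assert (s1 : s <= d / 2) by apply Rmin_l; assert (s2 : s <= t / 2) by apply Rmin_r.
  assert (C := Hd x s ltac:(rewrite Rminus_diag, Rabs_R0; trivial)
    ltac:(rewrite Rminus_0_r, Rabs_pos_eq; lra) ltac:(lra)).
  destruct (MVT_gen (fun s => E x s) s t (fun s => - (rho x s * u x s))) as [z [Hz Heq]];
    rewrite ?Rmin_left, ?Rmax_right in * by lra.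
  { intros z Hz; apply ep_solution_field_time; [lra|].
    apply (Rbar_lt_le_trans_real T _ tau); trivial; lra. }
  { intros z Hz; apply continuity_pt_filterlim.
    apply (is_derive_continuous (fun s => E x s) z (- (rho x z * u x z))),
      ep_solution_field_time; [lra|].
    apply (Rbar_lt_le_trans_real T _ tau); trivial; lra. }
  assert (D := H1 x z ltac:(lra) (Rle_lt_trans _ _ _ (Rmax_l _ _) Hx)).
  assert (F : Rabs (E x t - E x s) <= eta / (2 * (tau + 1)) * t).
  { rewrite Heq, Rabs_mult, Rabs_Ropp, (Rabs_pos_eq (t - s)) by lra.
    apply Rmult_le_compat; try lra; apply Rabs_pos. }
  assert (G := Rabs_triang (E x t - E x s) (E x s - E x 0)).
  replace (E x t - E x s + (E x s - E x 0)) with (E x t - E x 0) in G by ring.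
  unfold gap in C; lra. }
assert (C : eta / (2 * (tau + 1)) * t <= eta / 2).
{ replace (eta / 2) with (eta / (2 * (tau + 1)) * (tau + 1)) by (field; lra).
  apply Rmult_le_compat_l; [apply Rlt_le, Rdiv_lt_0_compat; lra|lra]. }
replace (E x t) with (E x 0 + (E x t - E x 0)) by ring.
eapply Rle_lt_trans; [apply Rabs_triang|lra].
Qed.

Hypothesis c_pos : 0 < c.

Definition transported_mode (mu m x t : R) : R := exp (mu * t) * (u x t - m * E x t / c).

Lemma transported_mode_continuous mu m :
  continuous_on_strip T (transported_mode mu m).
Proof.
assert (Eu := proj1 (ep_u_C1 _ _ _ _ _ _ _ _ _ sol)).
assert (EE := proj1 (ep_E_C1 _ _ _ _ _ _ _ _ _ sol)).
apply continuous_on_strip_mult.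
- apply continuous_on_strip_continuous; intros; continuity_arith.
- apply continuous_on_strip_minus; trivial.
  apply continuous_on_strip_mult; [|apply continuous_on_strip_const].
  apply continuous_on_strip_mult; [apply continuous_on_strip_const|trivial].
Qed.

(** Along the flow [E] has derivative [- rho u + u (rho - c) = - c u]. That of [u - m E / c] is then
    [k E - (mu + m) u + m u = - mu (u - m E / c)], because [mu m = c k], and the exponential factor
    cancels this decay. *)
Lemma transported_mode_transport mu m :
  mu * m = c * k -> mu + m = / eps ->
  exists Kx Kt : R -> R -> R, forall x t, 0 < t -> Rbar_lt t T ->
    is_derive (fun y => transported_mode mu m y t) x (Kx x t) /\
    is_derive (fun s => transported_mode mu m x s) t (Kt x t) /\
    Kt x t + u x t * Kx x t = 0.
Proof.
intros Hprod Hsum.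
destruct (ep_u_C1 _ _ _ _ _ _ _ _ _ sol) as [_ (ux & ut & _ & _ & Hux & Hut)].
exists (fun x t => exp (mu * t) * (ux x t - m * (rho x t - c) / c)).
exists (fun x t => mu * exp (mu * t) * (u x t - m * E x t / c)
  + exp (mu * t) * (ut x t - m * (- (rho x t * u x t)) / c)).
intros x t Ht HT.
assert (D1 := Hux x t (Rlt_le _ _ Ht) HT); assert (D2 := Hut x t Ht HT).
assert (D3 := ep_poisson _ _ _ _ _ _ _ _ _ sol x t (Rlt_le _ _ Ht) HT).
assert (D4 := ep_solution_field_time x t Ht HT).
assert (Q := ep_momentum _ _ _ _ _ _ _ _ _ sol x t Ht HT).
rewrite (Derive_eta _ _ _ D1), (Derive_eta _ _ _ D2) in Q.
split; [|split].
- unfold transported_mode; auto_derive.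
  + split; [now eexists; exact D1|split; [now eexists; exact D3|trivial]].
  + rewrite (Derive_eta (fun y => u y t) _ _ D1),
      (Derive_eta (fun y => E y t) _ _ D3); field; lra.
- unfold transported_mode; auto_derive.
  + split; [now eexists; exact D2|split; [now eexists; exact D4|trivial]].
  + rewrite (Derive_eta (fun s => u x s) _ _ D2),
      (Derive_eta (fun s => E x s) _ _ D4); field; lra.
- replace k with (mu * m / c) in Q by (rewrite Hprod; field; lra).
  unfold Rdiv in Q; rewrite <- Hsum in Q.
  replace (ut x t) with (mu * m * / c * E x t - u x t * (mu + m) - u x t * ux x t) by lra.
  field; lra.
Qed.

Lemma transported_mode_far mu m tau eta :
  0 <= mu -> 0 <= m -> 0 <= tau -> Rbar_lt tau T -> 0 < eta ->
  exists M, forall x t, 0 <= t <= tau -> M < Rabs x ->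
    Rabs (transported_mode mu m x t) < eta.
Proof.
intros Hmu Hm Htau HT He.
(* The exponential pays for the largest factor on [[0, tau]], and [2 * (m / c + 1)] for the terms in
   [u] and [E]. *)
pose (e := eta * exp (- (mu * tau)) / (2 * (m / c + 1))).
assert (hm : 0 <= m / c) by (apply Rdiv_le_0_compat; trivial).
assert (ep : 0 < e).
{ apply Rdiv_lt_0_compat; [apply Rmult_lt_0_compat; trivial; apply exp_pos|lra]. }
destruct (ep_u_far _ _ _ _ _ _ _ _ _ sol tau Htau HT e ep) as [M1 H1].
destruct (ep_solution_field_far tau e Htau HT ep) as [M2 H2].
exists (Rmax M1 M2); intros x t Ht Hx.
assert (A1 := H1 x t Ht (Rle_lt_trans _ _ _ (Rmax_l _ _) Hx)).
assert (A2 := H2 x t Ht (Rle_lt_trans _ _ _ (Rmax_r _ _) Hx)).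
unfold transported_mode; rewrite Rabs_mult, (Rabs_pos_eq (exp _)) by apply Rlt_le, exp_pos.
assert (B : Rabs (u x t - m * E x t / c) < eta * exp (- (mu * tau))).
{ replace (m * E x t / c) with (m / c * E x t) by (field; lra).
  eapply Rle_lt_trans; [apply Rabs_triang|].
  rewrite Rabs_Ropp, Rabs_mult, (Rabs_pos_eq (m / c)) by trivial.
  assert (D : (2 * (m / c + 1)) * e = eta * exp (- (mu * tau)))
    by (unfold e; field; lra).
  apply Rle_lt_trans with (Rabs (u x t) + m / c * e).
  - apply Rplus_le_compat_l, Rmult_le_compat_l; lra.
  - nra. }
assert (C : exp (mu * t) <= exp (mu * tau)).
{ destruct (Rle_lt_or_eq_dec _ _ (Rmult_le_compat_l mu t tau Hmu (proj2 Ht))) as [h|h].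
  - now apply Rlt_le, exp_increasing.
  - rewrite h; lra. }
apply Rle_lt_trans with (exp (mu * tau) * Rabs (u x t - m * E x t / c)).
- apply Rmult_le_compat_r; [apply Rabs_pos|trivial].
- apply (Rmult_lt_compat_l (exp (mu * tau))) in B; [|apply exp_pos].
  rewrite exp_Ropp in B.
  replace (exp (mu * tau) * (eta * / exp (mu * tau))) with eta in B; trivial.
  field; apply Rgt_not_eq, exp_pos.
Qed.

End SolutionProperties.

(** * The explicit solution *)

Section LagrangianFlow.

Variables (k c mu1 mu2 : R) (rho0 u0 u0' E0 : R -> R).
Hypotheses (c_pos : 0 < c) (mu1_pos : 0 < mu1) (mu1_lt_mu2 : mu1 < mu2)
  (mu_prod : mu1 * mu2 = c * k).
Hypotheses (rho0_cont : forall a, continuous rho0 a)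
  (rho0_pos : forall a, 0 < rho0 a)
  (rho0_far : lim_both rho0 c).
Hypotheses (u0_derive : forall a, is_derive u0 a (u0' a))
  (u0'_cont : forall a, continuous u0' a)
  (u0_far : lim_both u0 0).
Hypotheses (E0_derive : forall a, is_derive E0 a (rho0 a - c))
  (E0_far : lim_both E0 0).
Hypothesis threshold : forall a, 0 < u0' a \/ - (1 - rho0 a / c) * mu2 < u0' a.

(* Along characteristics u - mu2 E / c and u - mu1 E / c decay like
   exp (- mu1 t) and exp (- mu2 t); [mode mu2] and [mode mu1] are their
   initial values. *)
Definition mode (m a : R) : R := u0 a - m * E0 a / c.
Definition mode' (m a : R) : R := u0' a - m * (rho0 a / c - 1).

(** This is [a + (E0 a - field a t) / c]; both [E0] and [field] are obtained by subtracting the two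
    modes, which eliminates the velocity. *)
Definition flow (a t : R) : R :=
  a + ((1 - exp (- mu2 * t)) * mode mu1 a - (1 - exp (- mu1 * t)) * mode mu2 a) / (mu2 - mu1).
Definition jacobian (a t : R) : R :=
  1 + ((1 - exp (- mu2 * t)) * mode' mu1 a - (1 - exp (- mu1 * t)) * mode' mu2 a) / (mu2 - mu1).
Definition velocity (a t : R) : R :=
  (mu2 * exp (- mu2 * t) * mode mu1 a - mu1 * exp (- mu1 * t) * mode mu2 a) / (mu2 - mu1).
Definition velocity' (a t : R) : R :=
  (mu2 * exp (- mu2 * t) * mode' mu1 a - mu1 * exp (- mu1 * t) * mode' mu2 a) / (mu2 - mu1).
Definition field (a t : R) : R :=
  c * (exp (- mu2 * t) * mode mu1 a - exp (- mu1 * t) * mode mu2 a) / (mu2 - mu1).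

Lemma mode_derive m a : is_derive (mode m) a (mode' m a).
Proof.
unfold mode, mode'; auto_derive.
- split; [now exists (u0' a)|split; [now exists (rho0 a - c)|trivial]].
- rewrite (Derive_eta _ _ _ (u0_derive a)), (Derive_eta _ _ _ (E0_derive a)).
  field; lra.
Qed.

Lemma mode'_continuous m a : continuous (mode' m) a.
Proof.
unfold mode'; continuity_arith; auto; lra.
Qed.

Ltac derive_modes a :=
  auto_derive;
  [ repeat split; trivial; eexists; apply mode_derive
  | rewrite !(Derive_eta _ _ _ (mode_derive _ a)) ].

Lemma flow_derive_label a t : is_derive (fun b => flow b t) a (jacobian a t).
Proof. unfold flow, jacobian; derive_modes a; field; lra. Qed.

Lemma flow_derive_time a t : is_derive (fun s => flow a s) t (velocity a t).
Proof. unfold flow, velocity; auto_derive; trivial; field; lra. Qed.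

Lemma velocity_derive_label a t : is_derive (fun b => velocity b t) a (velocity' a t).
Proof. unfold velocity, velocity'; derive_modes a; field; lra. Qed.

Lemma velocity_derive_time a t :
  is_derive (fun s => velocity a s) t (k * field a t - (mu1 + mu2) * velocity a t).
Proof.
replace k with (mu1 * mu2 / c) by (rewrite mu_prod; field; lra).
unfold velocity, field; auto_derive; trivial; field; lra.
Qed.

Lemma jacobian_derive_time a t : is_derive (fun s => jacobian a s) t (velocity' a t).
Proof. unfold jacobian, velocity'; auto_derive; trivial; field; lra. Qed.

Ltac continuity_modes :=
  repeat (continuity_arith; lazymatch goal with
  | |- continuous (fun p => mode ?m (@?f p)) _ =>
      apply (continuous_real_comp (mode m)); [eapply is_derive_continuous, mode_derive|]
  | |- continuous (fun p => mode' ?m (@?f p)) _ =>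
      apply (continuous_real_comp (mode' m)); [apply mode'_continuous|]
  | |- _ <> _ => lra
  end).

Lemma jacobian_continuous (p : R * R) :
  continuous (fun q : R * R => jacobian (fst q) (snd q)) p.
Proof. unfold jacobian; continuity_modes. Qed.

Lemma velocity_continuous (p : R * R) :
  continuous (fun q : R * R => velocity (fst q) (snd q)) p.
Proof. unfold velocity; continuity_modes. Qed.

Lemma velocity'_continuous (p : R * R) :
  continuous (fun q : R * R => velocity' (fst q) (snd q)) p.
Proof. unfold velocity'; continuity_modes. Qed.

Lemma field_continuous (p : R * R) :
  continuous (fun q : R * R => field (fst q) (snd q)) p.
Proof. unfold field; continuity_modes. Qed.

Lemma field_flow a t : field a t = E0 a - c * (flow a t - a).
Proof. unfold field, flow, mode; field; lra. Qed.

(** The solution of [y'' + (mu1 + mu2) y' + mu1 mu2 y = 0] with [y = 0] and [y' = 1] at time 0. The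
    weight [exp (- mu1 * t) + mu1 * kernel t] used below is the solution with [y = 1] and
    [y' = 0]. *)
Definition kernel (t : R) : R := (exp (- mu1 * t) - exp (- mu2 * t)) / (mu2 - mu1).

Lemma kernel_nonneg t : 0 <= t -> 0 <= kernel t.
Proof.
intros Ht; apply Rmult_le_pos; [|apply Rlt_le, Rinv_0_lt_compat; lra].
destruct (Req_dec t 0) as [->|h]; [rewrite !Rmult_0_r; lra|].
apply Rlt_le, Rlt_0_minus, exp_increasing; nra.
Qed.

(** Regrouping the modes by initial data. With [w] the weight in parentheses, the part without [u0']
    equals [w + (1 - w) * (rho0 a / c)]. *)
Lemma jacobian_kernel a t :
  jacobian a t = 1 + (1 - (exp (- mu1 * t) + mu1 * kernel t)) * (rho0 a / c - 1)
    + kernel t * u0' a.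
Proof. unfold jacobian, mode', kernel; field; lra. Qed.

(** The weight is symmetric in the two rates; the second form fits the [mu2] in the threshold. *)
Lemma kernel_weight t : exp (- mu1 * t) + mu1 * kernel t = exp (- mu2 * t) + mu2 * kernel t.
Proof. unfold kernel; field; lra. Qed.

Lemma exp_decay_le_1 mu t : 0 < mu -> 0 <= t -> exp (- mu * t) <= 1.
Proof.
intros Hm Ht; rewrite <- exp_0; destruct (Req_dec t 0) as [->|h].
- rewrite Rmult_0_r; lra.
- apply Rlt_le, exp_increasing; nra.
Qed.

(* The convexity of x -> exp (- x t), at 0, mu1 and mu2. *)
Lemma kernel_weight_le_1 t : 0 <= t -> exp (- mu1 * t) + mu1 * kernel t <= 1.
Proof.
intros Ht.
pose (w := fun s => exp (- mu1 * s) + mu1 * kernel s).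
destruct (MVT_gen w 0 t (fun s => - (mu1 * mu2) * kernel s)) as [s [Hs Heq]].
- intros s _; unfold w, kernel; auto_derive; trivial; field; lra.
- intros s _; apply continuity_pt_filterlim.
  apply (is_derive_continuous w s (- (mu1 * mu2) * kernel s)).
  unfold w, kernel; auto_derive; trivial; field; lra.
- rewrite Rmin_left, Rmax_right in Hs by lra.
  assert (w0 : w 0 = 1).
  { unfold w, kernel; rewrite !Rmult_0_r, exp_0; field; lra. }
  change (w t <= 1).
  assert (A := kernel_nonneg s (proj1 Hs)).
  assert (0 <= mu1 * mu2 * kernel s * t).
  { apply Rmult_le_pos; [|lra]; apply Rmult_le_pos; [|trivial].
    apply Rmult_le_pos; lra. }
  lra.
Qed.

(** A positive slope can only raise a convex combination of [1] and [rho0 a / c]. In the other case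
    the bound on [u0'] cancels the part [mu2 * kernel t] of the weight, and a convex combination
    with weight [exp (- mu2 * t)] remains. *)
Lemma jacobian_lower a t : 0 <= t -> Rmin 1 (rho0 a / c) <= jacobian a t.
Proof.
intros Ht; rewrite jacobian_kernel.
assert (m1 := Rmin_l 1 (rho0 a / c)); assert (m2 := Rmin_r 1 (rho0 a / c)).
assert (hk := kernel_nonneg t Ht).
assert (hw := kernel_weight_le_1 t Ht).
assert (hw0 : 0 <= exp (- mu1 * t) + mu1 * kernel t).
{ generalize (exp_pos (- mu1 * t)); nra. }
destruct (threshold a) as [h|h].
- assert (0 <= kernel t * u0' a) by (apply Rmult_le_pos; lra).
  set (q := exp (- mu1 * t) + mu1 * kernel t) in *; nra.
- rewrite kernel_weight in *.
  assert (A : kernel t * (- (1 - rho0 a / c) * mu2) <= kernel t * u0' a).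
  { apply Rmult_le_compat_l; lra. }
  assert (B := exp_pos (- mu2 * t)).
  assert (C := exp_decay_le_1 mu2 t ltac:(lra) Ht).
  set (q := exp (- mu2 * t)) in *; nra.
Qed.

Lemma jacobian_pos a t : 0 <= t -> 0 < jacobian a t.
Proof.
intros Ht; eapply Rlt_le_trans; [|now apply jacobian_lower].
apply Rmin_pos; [lra|]; apply Rdiv_lt_0_compat; auto.
Qed.

Lemma flow_increasing t a b : 0 <= t -> a < b -> flow a t < flow b t.
Proof.
intros Ht Hab.
apply (incr_function (fun a => flow a t) m_infty p_infty (fun a => jacobian a t));
  simpl; trivial.
- intros; apply flow_derive_label.
- intros; now apply jacobian_pos.
Qed.

Lemma flow_injective t a b : 0 <= t -> flow a t = flow b t -> a = b.
Proof.
intros Ht Heq; destruct (Rtotal_order a b) as [h|[h|h]]; trivial;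
  generalize (flow_increasing t _ _ Ht h); lra.
Qed.

(** * Bounds on the modes and the flow, uniform in time *)

Lemma mode_far m : lim_both (mode m) 0.
Proof.
apply lim_both_epsilon; intros eta He.
pose (C := Rabs m / c + 1).
assert (hm : 0 <= Rabs m / c) by (apply Rdiv_le_0_compat; [apply Rabs_pos|trivial]).
destruct (proj1 (lim_both_epsilon _ _) u0_far (eta / 2) ltac:(lra)) as [M1 H1].
destruct (proj1 (lim_both_epsilon _ _) E0_far (eta / (2 * C))
  ltac:(apply Rdiv_lt_0_compat; unfold C; lra)) as [M2 H2].
exists (Rmax M1 M2); intros a Ha.
assert (A := H1 a (Rle_lt_trans _ _ _ (Rmax_l _ _) Ha)).
assert (B := H2 a (Rle_lt_trans _ _ _ (Rmax_r _ _) Ha)).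
rewrite Rminus_0_r in *; unfold mode.
replace (m * E0 a / c) with (m / c * E0 a) by (field; lra).
eapply Rle_lt_trans; [apply Rabs_triang|].
rewrite Rabs_Ropp, Rabs_mult.
replace (Rabs (m / c)) with (Rabs m / c)
  by (unfold Rdiv; rewrite Rabs_mult, (Rabs_right (/ c)); trivial;
      apply Rle_ge, Rlt_le, Rinv_0_lt_compat; trivial).
apply (Rmult_lt_compat_l C) in B; [|unfold C; lra].
replace (C * (eta / (2 * C))) with (eta / 2) in B by (field; unfold C; lra).
assert (D := Rabs_pos (E0 a)); unfold C in B; lra.
Qed.

Lemma mode_bounded m : exists B, forall a, Rabs (mode m a) <= B.
Proof.
apply (lim_both_bounded _ 0); [|apply mode_far].
intros a; eapply is_derive_continuous, mode_derive.
Qed.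


(** The modes are bounded and the factors [1 - exp (- mu * t)] lie in [[0, 1]]. The bound makes the
    flow map onto, and it makes the map and its inverse proper. *)
Lemma flow_displacement :
  exists K, forall a t, 0 <= t -> Rabs (flow a t - a) <= K.
Proof.
destruct (mode_bounded mu1) as [B1 H1]; destruct (mode_bounded mu2) as [B2 H2].
exists ((B1 + B2) / (mu2 - mu1)); intros a t Ht.
assert (w : forall mu m, 0 < mu -> Rabs ((1 - exp (- mu * t)) * m) <= Rabs m).
{ intros mu m Hmu; rewrite Rabs_mult.
  assert (A := exp_pos (- mu * t)); assert (B := exp_decay_le_1 mu t Hmu Ht).
  rewrite Rabs_pos_eq by lra; generalize (Rabs_pos m); nra. }
unfold flow; replace (_ - a) with
  (((1 - exp (- mu2 * t)) * mode mu1 a - (1 - exp (- mu1 * t)) * mode mu2 a)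
    / (mu2 - mu1)) by ring.
unfold Rdiv; rewrite Rabs_mult, (Rabs_pos_eq (/ _))
  by (apply Rlt_le, Rinv_0_lt_compat; lra).
apply Rmult_le_compat_r; [apply Rlt_le, Rinv_0_lt_compat; lra|].
eapply Rle_trans; [apply Rabs_triang|]; rewrite Rabs_Ropp.
apply Rplus_le_compat; eapply Rle_trans; try apply w; auto; lra.
Qed.

(** Velocity and field are both of this form, with time entering only through [p] and [q].
    Quantifying over all bounded coefficients makes the decay uniform in time. *)
Lemma mode_comb_far (A : R) : forall eta, 0 < eta -> exists M, forall a p q,
  Rabs p <= A -> Rabs q <= A -> M < Rabs a ->
  Rabs ((p * mode mu1 a - q * mode mu2 a) / (mu2 - mu1)) < eta.
Proof.
intros eta He.
pose (e := eta * (mu2 - mu1) / (2 * (Rabs A + 1))).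
assert (hA := Rabs_pos A); assert (hA' := Rle_abs A).
assert (ep : 0 < e).
{ apply Rdiv_lt_0_compat; [apply Rmult_lt_0_compat; lra|lra]. }
destruct (proj1 (lim_both_epsilon _ _) (mode_far mu1) e ep) as [M1 H1].
destruct (proj1 (lim_both_epsilon _ _) (mode_far mu2) e ep) as [M2 H2].
exists (Rmax M1 M2); intros a p q Hp Hq Ha.
assert (B1 := H1 a (Rle_lt_trans _ _ _ (Rmax_l _ _) Ha)).
assert (B2 := H2 a (Rle_lt_trans _ _ _ (Rmax_r _ _) Ha)).
rewrite Rminus_0_r in *.
unfold Rdiv; rewrite Rabs_mult, (Rabs_pos_eq (/ _))
  by (apply Rlt_le, Rinv_0_lt_compat; lra).
apply (Rmult_lt_reg_r (mu2 - mu1)); [lra|].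
rewrite Rmult_assoc, Rinv_l, Rmult_1_r by lra.
eapply Rle_lt_trans; [apply Rabs_triang|]; rewrite Rabs_Ropp, !Rabs_mult.
replace (eta * (mu2 - mu1)) with ((Rabs A + 1) * e + (Rabs A + 1) * e)
  by (unfold e; field; lra).
assert (C : forall r m, Rabs r <= A -> Rabs m < e ->
  Rabs r * Rabs m < (Rabs A + 1) * e).
{ intros r m Hr Hm; apply Rle_lt_trans with (Rabs r * e).
  - apply Rmult_le_compat_l; [apply Rabs_pos|lra].
  - apply Rmult_lt_compat_r; lra. }
apply Rplus_lt_compat; auto.
Qed.

Lemma exp_decay_Rabs m mu t : 0 < mu -> 0 <= t -> Rabs (m * exp (- mu * t)) <= Rabs m.
Proof.
intros Hmu Ht; rewrite Rabs_mult.
assert (A := exp_pos (- mu * t)); assert (B := exp_decay_le_1 mu t Hmu Ht).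
rewrite (Rabs_pos_eq (exp _)) by lra; generalize (Rabs_pos m); nra.
Qed.

Lemma velocity_far : forall eta, 0 < eta -> exists M, forall a t,
  0 <= t -> M < Rabs a -> Rabs (velocity a t) < eta.
Proof.
intros eta He; destruct (mode_comb_far mu2 eta He) as [M HM].
exists M; intros a t Ht Ha; apply HM; trivial;
  (eapply Rle_trans; [apply exp_decay_Rabs; lra|rewrite Rabs_pos_eq; lra]).
Qed.

Lemma field_far : forall eta, 0 < eta -> exists M, forall a t,
  0 <= t -> M < Rabs a -> Rabs (field a t) < eta.
Proof.
intros eta He; destruct (mode_comb_far c eta He) as [M HM].
exists M; intros a t Ht Ha; unfold field; rewrite Rmult_minus_distr_l, <- !Rmult_assoc.
apply HM; trivial;
  (eapply Rle_trans; [apply exp_decay_Rabs; lra|rewrite Rabs_pos_eq; lra]).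
Qed.

Lemma flow_label_exists :
  exists Y : R -> R -> R, forall x t, 0 <= t -> flow (Y x t) t = x.
Proof.
destruct flow_displacement as [K HK].
destruct (functional_choice (fun (p : R * R) a => 0 <= snd p -> flow a (snd p) = fst p))
  as [Y HY].
(* The label is chosen for all pairs at once; at negative times any value does, and 0 is taken. *)
- intros [x t]; simpl; destruct (Rle_dec 0 t) as [Ht|Ht]; [|now exists 0].
  destruct (IVT_gen (fun a => flow a t) (x - K) (x + K) x) as [a [_ Ha]].
  + intros a; apply continuity_pt_filterlim.
    exact (is_derive_continuous _ _ _ (flow_derive_label a t)).
  + assert (A := proj1 (Rabs_le_between _ _) (HK (x - K) t Ht)).
    assert (B := proj1 (Rabs_le_between _ _) (HK (x + K) t Ht)).
    split.
    * eapply Rle_trans; [apply Rmin_l|lra].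
    * eapply Rle_trans; [|apply Rmax_r]; lra.
  + now exists a.
- exists (fun x t => Y (x, t)); intros x t Ht; exact (HY (x, t) Ht).
Qed.

(** * The inverse flow map and its derivatives *)

Variable label : R -> R -> R.
Hypothesis flow_label : forall x t, 0 <= t -> flow (label x t) t = x.

Lemma label_flow a t : 0 <= t -> label (flow a t) t = a.
Proof. intros Ht; apply (flow_injective t); trivial; now apply flow_label. Qed.

Lemma label_lt x t a : 0 <= t -> x < flow a t -> label x t < a.
Proof.
intros Ht Hx; rewrite <- (flow_label x t Ht) in Hx.
apply Rnot_le_lt; intros [h|h].
- generalize (flow_increasing t _ _ Ht h); lra.
- rewrite h in Hx; lra.
Qed.

Lemma lt_label x t a : 0 <= t -> flow a t < x -> a < label x t.
Proof.
intros Ht Hx; rewrite <- (flow_label x t Ht) in Hx.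
apply Rnot_le_lt; intros [h|h].
- generalize (flow_increasing t _ _ Ht h); lra.
- rewrite h in Hx; lra.
Qed.

(** A point near [(x, t)] stays between the trajectories of [a - eta] and [a + eta], since
    monotonicity in the label holds at every time. This supplies the continuity that the implicit
    differentiation presupposes. *)
Lemma label_continuous T : continuous_on_strip T label.
Proof.
apply continuous_on_strip_epsilon; intros x t Ht _ eta He.
set (a := label x t).
assert (Hx : flow a t = x) by now apply flow_label.
assert (Hm := flow_increasing t (a - eta) a Ht ltac:(lra)).
assert (Hp := flow_increasing t a (a + eta) Ht ltac:(lra)).
rewrite Hx in Hm, Hp.
pose (gap := Rmin (x - flow (a - eta) t) (flow (a + eta) t - x) / 2).
assert (g1 := Rmin_l (x - flow (a - eta) t) (flow (a + eta) t - x)).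
assert (g2 := Rmin_r (x - flow (a - eta) t) (flow (a + eta) t - x)).
assert (gp : 0 < gap).
{ unfold gap; apply Rdiv_lt_0_compat; [apply Rmin_pos; lra|lra]. }
assert (C : forall b, continuous (fun s => flow b s) t).
{ intros b; exact (is_derive_continuous _ _ _ (flow_derive_time b t)). }
destruct (proj1 (filterlim_locally _ _) (C (a - eta)) (mkposreal _ gp)) as [d1 H1].
destruct (proj1 (filterlim_locally _ _) (C (a + eta)) (mkposreal _ gp)) as [d2 H2].
exists (Rmin gap (Rmin d1 d2)); split.
{ repeat apply Rmin_pos; trivial; apply cond_pos. }
intros x' t' Hx' Ht' Ht'0.
assert (A := H1 t' (Rlt_le_trans _ _ _ Ht'
  (Rle_trans _ _ _ (Rmin_r _ _) (Rmin_l _ _)))).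
assert (B := H2 t' (Rlt_le_trans _ _ _ Ht'
  (Rle_trans _ _ _ (Rmin_r _ _) (Rmin_r _ _)))).
assert (D := Rlt_le_trans _ _ _ Hx' (Rmin_l _ _)).
change (Rabs (flow (a - eta) t' - flow (a - eta) t) < gap) in A.
change (Rabs (flow (a + eta) t' - flow (a + eta) t) < gap) in B.
apply Rabs_def2 in A; apply Rabs_def2 in B; apply Rabs_def2 in D; unfold gap in *.
assert (L1 := lt_label x' t' (a - eta) Ht'0 ltac:(lra)).
assert (L2 := label_lt x' t' (a + eta) Ht'0 ltac:(lra)).
apply Rabs_def1; lra.
Qed.

Lemma label_displacement :
  exists K, forall x t, 0 <= t -> Rabs (label x t - x) <= K.
Proof.
destruct flow_displacement as [K HK]; exists K; intros x t Ht.
assert (A := HK (label x t) t Ht); rewrite flow_label in A by trivial.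
now rewrite Rabs_minus_sym.
Qed.

Lemma label_far (A : R) : exists M, forall x t, 0 <= t -> M < Rabs x -> A < Rabs (label x t).
Proof.
destruct label_displacement as [K HK]; exists (A + K); intros x t Ht Hx.
assert (B := HK x t Ht).
assert (C := Rabs_triang (label x t) (x - label x t)).
replace (label x t + (x - label x t)) with x in C by ring.
rewrite (Rabs_minus_sym x) in C; lra.
Qed.

Lemma continuous_on_strip_label T (h : R -> R -> R) :
  (forall a t, 0 <= t -> continuous (fun p : R * R => h (fst p) (snd p)) (a, t)) ->
  continuous_on_strip T (fun x t => h (label x t) t).
Proof.
intros Hh; apply (continuous_on_strip_comp2 T h label (fun _ t => t)).
- apply label_continuous.
- apply continuous_on_strip_snd.
- auto.
Qed.

Lemma flow_differentiable a t :
  differentiable_pt_lim flow a t (jacobian a t) (velocity a t).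
Proof.
apply differentiable_pt_lim_partials.
- apply filter_forall; intros p; apply flow_derive_label.
- apply flow_derive_time.
- apply jacobian_continuous.
Qed.

Lemma velocity_differentiable a t :
  differentiable_pt_lim velocity a t (velocity' a t)
    (k * field a t - (mu1 + mu2) * velocity a t).
Proof.
apply differentiable_pt_lim_partials.
- apply filter_forall; intros p; apply velocity_derive_label.
- apply velocity_derive_time.
- apply velocity'_continuous.
Qed.

Lemma label_derive_space x t :
  0 <= t -> is_derive (fun y => label y t) x (/ jacobian (label x t) t).
Proof.
intros Ht; assert (J := jacobian_pos (label x t) t Ht).
replace (/ jacobian (label x t) t) with
  ((1 - velocity (label x t) t * 0) / jacobian (label x t) t) by (field; lra).
apply (is_derive_implicit flow (fun y => label y t) (fun _ => t) (fun y => y)).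
- apply flow_differentiable.
- lra.
- apply (continuous_on_strip_slice p_infty); simpl; trivial; apply label_continuous.
- apply (is_derive_const t).
- apply (is_derive_id x).
- apply filter_forall; intros y; now apply flow_label.
Qed.

Lemma locally_positive (t : R) : 0 < t -> locally t (fun s => 0 < s).
Proof.
intros Ht; exists (mkposreal t Ht); intros s Hs.
change (Rabs (s - t) < t) in Hs; apply Rabs_def2 in Hs; lra.
Qed.

Lemma label_derive_time x t :
  0 < t -> is_derive (fun s => label x s) t
    (- velocity (label x t) t / jacobian (label x t) t).
Proof.
intros Ht; assert (J := jacobian_pos (label x t) t (Rlt_le _ _ Ht)).
replace (- velocity (label x t) t) with (0 - velocity (label x t) t * 1) by ring.
apply (is_derive_implicit flow (fun s => label x s) (fun s => s) (fun _ => x)).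
- apply flow_differentiable.
- lra.
- apply filterlim_locally; intros e.
  destruct (proj1 (continuous_on_strip_epsilon p_infty _) (label_continuous _) x t
    (Rlt_le _ _ Ht) I e (cond_pos e)) as [d [dp Hd]].
  generalize (filter_and _ _ (locally_ball t (mkposreal d dp)) (locally_positive t Ht)).
  apply filter_imp; intros s [H1 H2]; apply Hd; [|exact H1|lra].
  rewrite Rminus_diag, Rabs_R0; trivial.
- apply (is_derive_id t).
- apply (is_derive_const x).
- generalize (locally_positive t Ht); apply filter_imp; intros s Hs.
  apply flow_label; lra.
Qed.

(** * The solution in Eulerian coordinates *)

Definition euler_u (x t : R) : R := velocity (label x t) t.
Definition euler_E (x t : R) : R := field (label x t) t.
Definition euler_rho (x t : R) : R := rho0 (label x t) / jacobian (label x t) t.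

Lemma label_comp_derive_space (h : R -> R -> R) x t ha ht :
  0 <= t -> differentiable_pt_lim h (label x t) t ha ht ->
  is_derive (fun y => h (label y t) t) x (ha / jacobian (label x t) t).
Proof.
intros Ht Hh.
replace (ha / jacobian (label x t) t) with (ha * / jacobian (label x t) t + ht * 0)
  by (unfold Rdiv; ring).
apply (is_derive_comp_2d h (fun y => label y t) (fun _ => t)); trivial.
- now apply label_derive_space.
- apply (is_derive_const t).
Qed.

(** Labels are transported, [label_t = - u label_x], so the time derivative at a fixed place is the
    one along the characteristic minus [u] times the space derivative. *)
Lemma label_comp_derive_time (h : R -> R -> R) x t ha ht :
  0 < t -> differentiable_pt_lim h (label x t) t ha ht ->
  is_derive (fun s => h (label x s) s) t
    (ht - euler_u x t * (ha / jacobian (label x t) t)).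
Proof.
intros Ht Hh; assert (J := jacobian_pos (label x t) t (Rlt_le _ _ Ht)).
replace (ht - euler_u x t * (ha / jacobian (label x t) t)) with
  (ha * (- velocity (label x t) t / jacobian (label x t) t) + ht * 1)
  by (unfold euler_u; field; lra).
apply (is_derive_comp_2d h (fun s => label x s) (fun s => s)); trivial.
- now apply label_derive_time.
- apply (is_derive_id t).
Qed.

Lemma label_init x : label x 0 = x.
Proof.
rewrite <- (flow_label x 0 (Rle_refl 0)) at 2; unfold flow.
rewrite !Rmult_0_r, exp_0; field; lra.
Qed.

(** In this form [E] depends on time only through the label. Its derivatives need just
    [E0' = rho0 - c] and those of the label, and no derivative of the density. *)
Lemma euler_E_label x t : 0 <= t -> euler_E x t = E0 (label x t) + c * label x t - c * x.
Proof. intros Ht; unfold euler_E; rewrite field_flow, flow_label by trivial; ring. Qed.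

Lemma euler_u_derive_space x t :
  0 <= t -> is_derive (fun y => euler_u y t) x
    (velocity' (label x t) t / jacobian (label x t) t).
Proof.
intros Ht; eapply label_comp_derive_space; trivial; apply velocity_differentiable.
Qed.

Lemma euler_u_derive_time x t :
  0 < t -> is_derive (fun s => euler_u x s) t
    (k * euler_E x t - (mu1 + mu2) * euler_u x t
     - euler_u x t * (velocity' (label x t) t / jacobian (label x t) t)).
Proof.
intros Ht; eapply label_comp_derive_time; trivial; apply velocity_differentiable.
Qed.

Lemma euler_E_derive_space x t :
  0 <= t -> is_derive (fun y => euler_E y t) x (euler_rho x t - c).
Proof.
intros Ht; assert (J := jacobian_pos (label x t) t Ht).
apply (is_derive_ext (fun y => E0 (label y t) + c * label y t - c * y)).
{ intros y; now rewrite euler_E_label. }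
assert (D := label_derive_space x t Ht).
auto_derive.
- split; [now eexists; apply E0_derive|split; [now eexists; exact D|]].
  split; [now eexists; exact D|trivial].
- rewrite (Derive_eta _ _ _ (E0_derive (label x t))),
    (Derive_eta (fun y => label y t) _ _ D).
  unfold euler_rho; field; lra.
Qed.

Lemma euler_E_derive_time x t :
  0 < t -> is_derive (fun s => euler_E x s) t (- (euler_rho x t * euler_u x t)).
Proof.
intros Ht; assert (J := jacobian_pos (label x t) t (Rlt_le _ _ Ht)).
apply (is_derive_ext_loc (fun s => E0 (label x s) + c * label x s - c * x)).
{ generalize (locally_positive t Ht); apply filter_imp; intros s Hs.
  rewrite euler_E_label; trivial; lra. }
assert (D := label_derive_time x t Ht).
auto_derive.
- split; [now eexists; apply E0_derive|split; [now eexists; exact D|]].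
  split; [now eexists; exact D|trivial].
- rewrite (Derive_eta _ _ _ (E0_derive (label x t))),
    (Derive_eta (fun s => label x s) _ _ D).
  unfold euler_rho, euler_u; field; lra.
Qed.

Lemma euler_u_continuous T : continuous_on_strip T euler_u.
Proof. apply continuous_on_strip_label; intros; apply velocity_continuous. Qed.

Lemma euler_E_continuous T : continuous_on_strip T euler_E.
Proof. apply continuous_on_strip_label; intros; apply field_continuous. Qed.

Lemma euler_rho_continuous T : continuous_on_strip T euler_rho.
Proof.
apply (continuous_on_strip_label T (fun a t => rho0 a / jacobian a t)); intros a t Ht.
apply (continuous_Rdiv (fun p => rho0 (fst p)) (fun p => jacobian (fst p) (snd p))).
- apply continuous_real_comp; [apply rho0_cont|apply continuous_fst].
- apply jacobian_continuous.
- simpl; generalize (jacobian_pos a t Ht); lra.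
Qed.

Lemma euler_ux_continuous T :
  continuous_on_strip T (fun x t => velocity' (label x t) t / jacobian (label x t) t).
Proof.
apply (continuous_on_strip_label T (fun a t => velocity' a t / jacobian a t)); intros a t Ht.
apply (continuous_Rdiv (fun p => velocity' (fst p) (snd p))
  (fun p => jacobian (fst p) (snd p))).
- apply velocity'_continuous.
- apply jacobian_continuous.
- simpl; generalize (jacobian_pos a t Ht); lra.
Qed.

Lemma euler_u_C1 T : C1_on_strip T euler_u.
Proof.
split; [apply euler_u_continuous|].
exists (fun x t => velocity' (label x t) t / jacobian (label x t) t).
exists (fun x t => k * euler_E x t - (mu1 + mu2) * euler_u x t
     - euler_u x t * (velocity' (label x t) t / jacobian (label x t) t)).
split; [apply euler_ux_continuous|split; [|split]].
- apply continuous_on_strip_minus; [apply continuous_on_strip_minus|];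
    apply continuous_on_strip_mult; try apply continuous_on_strip_const.
  + apply euler_E_continuous.
  + apply euler_u_continuous.
  + apply euler_u_continuous.
  + apply euler_ux_continuous.
- intros; now apply euler_u_derive_space.
- intros; now apply euler_u_derive_time.
Qed.

Lemma euler_E_C1 T : C1_on_strip T euler_E.
Proof.
split; [apply euler_E_continuous|].
exists (fun x t => euler_rho x t - c), (fun x t => - (euler_rho x t * euler_u x t)).
split; [|split; [|split]].
- apply continuous_on_strip_minus;
    [apply euler_rho_continuous|apply continuous_on_strip_const].
- apply continuous_on_strip_opp, continuous_on_strip_mult;
    [apply euler_rho_continuous|apply euler_u_continuous].
- intros; now apply euler_E_derive_space.
- intros; now apply euler_E_derive_time.
Qed.

Lemma euler_rho_slice t x : 0 <= t -> continuous (fun y => euler_rho y t) x.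
Proof.
intros Ht; apply (continuous_on_strip_slice p_infty); simpl; trivial.
apply euler_rho_continuous.
Qed.

Lemma euler_rho_RInt a b t :
  0 <= t -> RInt (fun y => euler_rho y t) a b = euler_E b t - euler_E a t + c * (b - a).
Proof.
intros Ht.
replace (euler_E b t - euler_E a t + c * (b - a)) with
  (euler_E b t + c * b - (euler_E a t + c * a)) by ring.
apply is_RInt_unique.
apply (is_RInt_antiderivative (fun y => euler_rho y t) (fun y => euler_E y t + c * y)).
- intros y; replace (euler_rho y t) with (euler_rho y t - c + c) by ring.
  apply (is_derive_plus (fun y => euler_E y t) (fun y => c * y)).
  + now apply euler_E_derive_space.
  + auto_derive; trivial; ring.
- intros y; now apply euler_rho_slice.
Qed.

(** The mass over [[a, b]] is a difference of values of [E] plus a constant, so the known [E_t] at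
    the two ends suffices and [rho] need not be differentiable. *)
Lemma euler_mass a b t :
  0 < t -> is_derive (fun s => RInt (fun x => euler_rho x s) a b) t
    (euler_rho a t * euler_u a t - euler_rho b t * euler_u b t).
Proof.
intros Ht.
apply (is_derive_ext_loc (fun s => (euler_E b s - euler_E a s) + c * (b - a))).
{ generalize (locally_positive t Ht); apply filter_imp; intros s Hs.
  rewrite euler_rho_RInt; trivial; lra. }
replace (euler_rho a t * euler_u a t - euler_rho b t * euler_u b t) with
  (- (euler_rho b t * euler_u b t) - - (euler_rho a t * euler_u a t) + 0) by ring.
apply (is_derive_plus (fun s => euler_E b s - euler_E a s) (fun _ => c * (b - a))).
- apply (is_derive_minus (fun s => euler_E b s) (fun s => euler_E a s));
    now apply euler_E_derive_time.
- apply (is_derive_const (c * (b - a))).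
Qed.

Lemma euler_E_lim t : 0 <= t -> lim_both (fun x => euler_E x t) 0.
Proof.
intros Ht; apply lim_both_epsilon; intros eta He.
destruct (field_far eta He) as [A HA]; destruct (label_far A) as [M HM].
exists M; intros x Hx; rewrite Rminus_0_r; apply HA; auto.
Qed.

Lemma euler_u_far eta :
  0 < eta -> exists M, forall x t, 0 <= t -> M < Rabs x -> Rabs (euler_u x t) < eta.
Proof.
intros He; destruct (velocity_far eta He) as [A HA]; destruct (label_far A) as [M HM].
exists M; intros x t Ht Hx; apply HA; auto.
Qed.

(** A Jacobian of at least [1] gives a density of at most [rho0], and one of at least [rho0 / c]
    gives at most [c]; [B + c] covers both cases. *)
Lemma euler_rho_bounded :
  exists M, forall x t, 0 <= t -> Rabs (euler_rho x t) <= M.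
Proof.
destruct (lim_both_bounded rho0 c rho0_cont rho0_far) as [B HB].
exists (B + c); intros x t Ht; unfold euler_rho; set (a := label x t).
assert (J := jacobian_pos a t Ht); assert (L := jacobian_lower a t Ht).
assert (P := rho0_pos a); assert (Hb := HB a); rewrite Rabs_pos_eq in Hb by lra.
rewrite Rabs_pos_eq by (apply Rlt_le, Rdiv_lt_0_compat; lra).
apply (Rmult_le_reg_r (jacobian a t)); trivial.
unfold Rdiv; rewrite Rmult_assoc, Rinv_l, Rmult_1_r by lra.
revert L; unfold Rmin; destruct Rle_dec as [h|h]; intros L; [nra|].
apply (Rmult_le_compat_l c) in L; [|lra].
replace (c * (rho0 a / c)) with (rho0 a) in L by (field; lra); nra.
Qed.

(** * Verification of the system and uniqueness *)

Variable eps : R.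
Hypothesis mu_sum : mu1 + mu2 = / eps.

Lemma euler_momentum x t :
  0 < t -> Derive (fun s => euler_u x s) t + euler_u x t * Derive (fun y => euler_u y t) x
    = k * euler_E x t - euler_u x t / eps.
Proof.
intros Ht.
rewrite (Derive_eta _ _ _ (euler_u_derive_time x t Ht)),
  (Derive_eta (fun y => euler_u y t) _ _ (euler_u_derive_space x t (Rlt_le _ _ Ht))).
unfold Rdiv at 3; rewrite <- mu_sum; ring.
Qed.

Lemma euler_ep_solution : ep_solution k c eps rho0 u0 p_infty euler_rho euler_u euler_E.
Proof.
split.
- intros x; unfold euler_rho; rewrite label_init; unfold jacobian.
  rewrite !Rmult_0_r, exp_0; field; lra.
- intros x; unfold euler_u; rewrite label_init; unfold velocity, mode.
  rewrite !Rmult_0_r, exp_0; field; lra.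
- apply euler_rho_continuous.
- apply euler_u_C1.
- apply euler_E_C1.
- intros; now apply euler_mass.
- intros; now apply euler_momentum.
- intros; now apply euler_E_derive_space.
- intros x t Ht _; rewrite <- (Rminus_0_r (euler_E x t)).
  apply (is_RInt_gen_antiderivative_left (fun y => euler_rho y t - c)
    (fun y => euler_E y t)).
  + intros y; now apply euler_E_derive_space.
  + intros y; apply (continuous_Rminus (fun y => euler_rho y t) (fun _ => c));
      [now apply euler_rho_slice|apply continuous_const].
  + now apply euler_E_lim.
- intros t Ht _.
  apply (is_RInt_gen_antiderivative_both (fun y => euler_rho y t - c)
    (fun y => euler_E y t)) with (L := 0).
  + intros y; now apply euler_E_derive_space.
  + intros y; apply (continuous_Rminus (fun y => euler_rho y t) (fun _ => c));
      [now apply euler_rho_slice|apply continuous_const].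
  + now apply euler_E_lim.
- intros tau _ _ eta He; destruct (euler_u_far eta He) as [M HM].
  exists M; intros x t [Ht _]; now apply HM.
- intros tau _ _; destruct euler_rho_bounded as [M HM].
  exists M; intros x t [Ht _]; now apply HM.
Qed.

(* The modes carried by any solution and the label recovered from them are
   constant along its velocity field, so they must be the initial modes at
   that label: the solution is the explicit one. *)
Lemma euler_unique_velocity_field (T : Rbar) (r v F : R -> R -> R) :
  ep_solution k c eps rho0 u0 T r v F ->
  forall x t, 0 <= t -> Rbar_lt t T -> v x t = euler_u x t /\ F x t = euler_E x t.
Proof.
intros sol.
pose (K1 := transported_mode c v F mu1 mu2).
pose (K2 := transported_mode c v F mu2 mu1).
(* The recovered label solves [c A + E0 A = c x + F], with [E0 / c] replaced by the difference of
   the initial modes over [mu2 - mu1], which [K2] and [K1] carry along. *)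
pose (A := fun x t => x + F x t / c - (K2 x t - K1 x t) / (mu2 - mu1)).
destruct (transported_mode_transport _ _ _ _ _ _ _ _ _ sol c_pos mu1 mu2 mu_prod mu_sum)
  as (K1x & K1t & HK1); fold K1 in HK1.
destruct (transported_mode_transport _ _ _ _ _ _ _ _ _ sol c_pos mu2 mu1
  ltac:(lra) ltac:(lra)) as (K2x & K2t & HK2); fold K2 in HK2.
assert (K1c := transported_mode_continuous _ _ _ _ _ _ _ _ _ sol mu1 mu2); fold K1 in K1c.
assert (K2c := transported_mode_continuous _ _ _ _ _ _ _ _ _ sol mu2 mu1); fold K2 in K2c.
assert (Fc := proj1 (ep_E_C1 _ _ _ _ _ _ _ _ _ sol)).
assert (Ac : continuous_on_strip T A).
{ unfold A; apply continuous_on_strip_minus; [apply continuous_on_strip_plus|].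
  - apply continuous_on_strip_fst.
  - apply continuous_on_strip_mult; [trivial|apply continuous_on_strip_const].
  - apply continuous_on_strip_mult; [|apply continuous_on_strip_const].
    now apply continuous_on_strip_minus. }
pose (Ax := fun x t => 1 + (r x t - c) / c - (K2x x t - K1x x t) / (mu2 - mu1)).
pose (At := fun x t => - (r x t * v x t) / c - (K2t x t - K1t x t) / (mu2 - mu1)).
assert (HA : forall x t, 0 < t -> Rbar_lt t T ->
  is_derive (fun y => A y t) x (Ax x t) /\ is_derive (fun s => A x s) t (At x t) /\
  At x t + v x t * Ax x t = 0).
{ intros x t Ht HT.
  destruct (HK1 x t Ht HT) as (D1 & D2 & Q1); destruct (HK2 x t Ht HT) as (D3 & D4 & Q2).
  assert (D5 := ep_poisson _ _ _ _ _ _ _ _ _ sol x t (Rlt_le _ _ Ht) HT).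
  assert (D6 := ep_solution_field_time _ _ _ _ _ _ _ _ _ sol x t Ht HT).
  split; [|split].
  - unfold A; auto_derive.
    + repeat split; trivial; eexists; eassumption.
    + rewrite (Derive_eta (fun y => F y t) _ _ D5), (Derive_eta (fun y => K1 y t) _ _ D1),
        (Derive_eta (fun y => K2 y t) _ _ D3); unfold Ax; field; lra.
  - unfold A; auto_derive.
    + repeat split; trivial; eexists; eassumption.
    + rewrite (Derive_eta (fun s => F x s) _ _ D6), (Derive_eta (fun s => K1 x s) _ _ D2),
        (Derive_eta (fun s => K2 x s) _ _ D4); unfold At; field; lra.
  - unfold At, Ax.
    replace (K1t x t) with (- (v x t * K1x x t)) by lra.
    replace (K2t x t) with (- (v x t * K2x x t)) by lra.
    field; lra. }
intros x t Ht HT.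
assert (HT0 : Rbar_lt 0 T) by now apply (Rbar_lt_le_trans_real T 0 t).
(* Both have derivative [rho0 - c] and both vanish at the left end. *)
assert (F0 : forall y, F y 0 = E0 y).
{ intros y.
  assert (L : is_lim E0 m_infty (E0 y - F y 0)).
  { apply (is_RInt_gen_antiderivative_lim_left (fun z => r z 0 - c)).
    - intros z; rewrite (ep_rho_init _ _ _ _ _ _ _ _ _ sol); apply E0_derive.
    - intros z; apply (continuous_Rminus (fun z => r z 0) (fun _ => c));
        [|apply continuous_const].
      apply (continuous_on_strip_slice T); trivial; [|lra].
      apply (ep_rho_cont _ _ _ _ _ _ _ _ _ sol).
    - apply (ep_E_integral _ _ _ _ _ _ _ _ _ sol); trivial; lra. }
  apply is_lim_unique in L; rewrite (is_lim_unique _ _ _ (proj1 E0_far)) in L.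
  injection L; lra. }
assert (A0 : forall y, A y 0 = y).
{ intros y; unfold A, K1, K2, transported_mode; rewrite !Rmult_0_r, exp_0; field; lra. }
assert (K10 : forall y, K1 y 0 = mode mu2 y).
{ intros y; unfold K1, transported_mode, mode.
  rewrite F0, (ep_u_init _ _ _ _ _ _ _ _ _ sol), Rmult_0_r, exp_0; ring. }
assert (K20 : forall y, K2 y 0 = mode mu1 y).
{ intros y; unfold K2, transported_mode, mode.
  rewrite F0, (ep_u_init _ _ _ _ _ _ _ _ _ sol), Rmult_0_r, exp_0; ring. }
assert (A_far : forall eta, 0 < eta -> exists M, forall y s, 0 <= s <= t -> M < Rabs y ->
  Rabs (A y s - y) < eta).
{ intros eta He.
  (* [C] is the sum of the sizes of the coefficients of [F], [K1] and [K2] in [A y s - y]. *)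
  pose (C := / c + 2 / (mu2 - mu1)).
  assert (i1 : 0 < / c) by now apply Rinv_0_lt_compat.
  assert (i2 : 0 < / (mu2 - mu1)) by (apply Rinv_0_lt_compat; lra).
  assert (Cp : 0 < C) by (unfold C, Rdiv; lra).
  assert (ep : 0 < eta / C) by now apply Rdiv_lt_0_compat.
  destruct (ep_solution_field_far _ _ _ _ _ _ _ _ _ sol t (eta / C)) as [M0 H0]; trivial.
  destruct (transported_mode_far _ _ _ _ _ _ _ _ _ sol c_pos mu1 mu2 t (eta / C))
    as [M1 H1]; trivial; try lra.
  destruct (transported_mode_far _ _ _ _ _ _ _ _ _ sol c_pos mu2 mu1 t (eta / C))
    as [M2 H2]; trivial; try lra.
  exists (Rmax M0 (Rmax M1 M2)); intros y s Hs Hy.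
  assert (B0 := H0 y s Hs (Rle_lt_trans _ _ _ (Rmax_l _ _) Hy)).
  assert (Hy' := Rle_lt_trans _ _ _ (Rmax_r _ _) Hy).
  assert (B1 := H1 y s Hs (Rle_lt_trans _ _ _ (Rmax_l _ _) Hy')); fold K1 in B1.
  assert (B2 := H2 y s Hs (Rle_lt_trans _ _ _ (Rmax_r _ _) Hy')); fold K2 in B2.
  replace (A y s - y) with
    (F y s * / c + (- K2 y s * / (mu2 - mu1) + K1 y s * / (mu2 - mu1)))
    by (unfold A; field; lra).
  replace eta with
    (eta / C * / c + (eta / C * / (mu2 - mu1) + eta / C * / (mu2 - mu1)))
    by (unfold C in *; field; lra).
  assert (S : forall a i, 0 < i -> Rabs a < eta / C -> Rabs (a * i) < eta / C * i).
  { intros a i Hi Ha; rewrite Rabs_mult, (Rabs_pos_eq i) by lra.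
    now apply Rmult_lt_compat_r. }
  eapply Rle_lt_trans; [apply Rabs_triang|apply Rplus_lt_compat; auto].
  eapply Rle_lt_trans; [apply Rabs_triang|apply Rplus_lt_compat; auto].
  apply S; trivial; now rewrite Rabs_Ropp. }
(* Any function of [A] is transported as well, so [K - mode m A] satisfies the transport equation
   with zero initial values and decays at infinity. *)
assert (HZ : forall m K Kx Kt, continuous_on_strip T K ->
  (forall y s, 0 < s -> Rbar_lt s T -> is_derive (fun y => K y s) y (Kx y s) /\
    is_derive (fun s => K y s) s (Kt y s) /\ Kt y s + v y s * Kx y s = 0) ->
  (forall y, K y 0 = mode m y) ->
  (forall eta, 0 < eta -> exists M, forall y s, 0 <= s <= t -> M < Rabs y ->
    Rabs (K y s) < eta) ->
  K x t = mode m (A x t)).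
{ intros m K Kx Kt Kc HK Kinit Kfar; apply Rminus_diag_uniq.
  assert (lt_T : forall s, s <= t -> Rbar_lt s T).
  { intros s Hs; now apply (Rbar_lt_le_trans_real T s t). }
  apply (transport_zero T v (fun y s => K y s - mode m (A y s))
    (fun y s => Kx y s - Ax y s * mode' m (A y s))
    (fun y s => Kt y s - At y s * mode' m (A y s)) t); trivial.
  - apply continuous_on_strip_minus; trivial.
    apply continuous_on_strip_comp; trivial.
    intros a; eapply is_derive_continuous, mode_derive.
  - intros y s Hs.
    destruct (HK y s (proj1 Hs) (lt_T s (proj2 Hs))) as (D1 & _ & _).
    destruct (HA y s (proj1 Hs) (lt_T s (proj2 Hs))) as (D2 & _ & _).
    apply (is_derive_minus (fun y => K y s) (fun y => mode m (A y s))); trivial.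
    apply (is_derive_comp (mode m) (fun y => A y s)); trivial; apply mode_derive.
  - intros y s Hs.
    destruct (HK y s (proj1 Hs) (lt_T s (proj2 Hs))) as (_ & D1 & _).
    destruct (HA y s (proj1 Hs) (lt_T s (proj2 Hs))) as (_ & D2 & _).
    apply (is_derive_minus (fun s => K y s) (fun s => mode m (A y s))); trivial.
    apply (is_derive_comp (mode m) (fun s => A y s)); trivial; apply mode_derive.
  - intros y s Hs.
    destruct (HK y s (proj1 Hs) (lt_T s (proj2 Hs))) as (_ & _ & Q1).
    destruct (HA y s (proj1 Hs) (lt_T s (proj2 Hs))) as (_ & _ & Q2).
    replace (Kt y s) with (- (v y s * Kx y s)) by lra.
    replace (At y s) with (- (v y s * Ax y s)) by lra; ring.
  - intros y; rewrite Kinit, A0; ring.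
  - intros eta He.
    destruct (Kfar (eta / 2) ltac:(lra)) as [M1 H1].
    destruct (proj1 (lim_both_epsilon _ _) (mode_far m) (eta / 2) ltac:(lra)) as [M2 H2].
    destruct (A_far 1 Rlt_0_1) as [M3 H3].
    (* Beyond [M3] the recovered label is within 1 of [y], hence the [M2 + 1]. *)
    exists (Rmax M1 (Rmax (M2 + 1) M3)); intros y s Hs Hy.
    assert (B1 := H1 y s Hs (Rle_lt_trans _ _ _ (Rmax_l _ _) Hy)).
    assert (Hy' := Rle_lt_trans _ _ _ (Rmax_r _ _) Hy).
    assert (B2 := Rle_lt_trans _ _ _ (Rmax_l _ _) Hy').
    assert (B3 := H3 y s Hs (Rle_lt_trans _ _ _ (Rmax_r _ _) Hy')).
    assert (B4 : M2 < Rabs (A y s)).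
    { assert (B5 := Rabs_triang (A y s) (y - A y s)).
      replace (A y s + (y - A y s)) with y in B5 by ring.
      rewrite (Rabs_minus_sym y) in B5; lra. }
    assert (B5 := H2 _ B4); rewrite Rminus_0_r in B5.
    eapply Rle_lt_trans; [apply Rabs_triang|]; rewrite Rabs_Ropp; lra.
  - lra. }
assert (E1 : K1 x t = mode mu2 (A x t)).
{ apply (HZ mu2 K1 K1x K1t); trivial.
  intros eta He; apply (transported_mode_far _ _ _ _ _ _ _ _ _ sol); trivial; lra. }
assert (E2 : K2 x t = mode mu1 (A x t)).
{ apply (HZ mu1 K2 K2x K2t); trivial.
  intros eta He; apply (transported_mode_far _ _ _ _ _ _ _ _ _ sol); trivial; lra. }
assert (M1 : exp (- mu1 * t) * mode mu2 (A x t) = v x t - mu2 * F x t / c).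
{ rewrite <- E1; unfold K1, transported_mode; rewrite <- Rmult_assoc, <- exp_plus.
  replace (- mu1 * t + mu1 * t) with 0 by ring; rewrite exp_0; ring. }
assert (M2 : exp (- mu2 * t) * mode mu1 (A x t) = v x t - mu1 * F x t / c).
{ rewrite <- E2; unfold K2, transported_mode; rewrite <- Rmult_assoc, <- exp_plus.
  replace (- mu2 * t + mu2 * t) with 0 by ring; rewrite exp_0; ring. }
(* With both modes identified, [A] solves the flow equation, and injectivity of the flow makes it
   the label. *)
assert (HX : flow (A x t) t = x).
{ unfold flow.
  replace ((1 - exp (- mu2 * t)) * mode mu1 (A x t)) with
    (K2 x t - exp (- mu2 * t) * mode mu1 (A x t)) by (rewrite E2; ring).
  replace ((1 - exp (- mu1 * t)) * mode mu2 (A x t)) with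
    (K1 x t - exp (- mu1 * t) * mode mu2 (A x t)) by (rewrite E1; ring).
  rewrite M1, M2; unfold A; field; lra. }
assert (HY : label x t = A x t) by (rewrite <- HX at 1; now apply label_flow).
unfold euler_u, euler_E; rewrite HY; split.
- unfold velocity; rewrite !Rmult_assoc, M1, M2; field; lra.
- unfold field; rewrite M1, M2; field; lra.
Qed.

(** The density of any solution is [E_x + c], hence determined once the fields agree. *)
Lemma euler_unique (T : Rbar) (r v F : R -> R -> R) :
  ep_solution k c eps rho0 u0 T r v F ->
  forall x t, 0 <= t -> Rbar_lt t T ->
    r x t = euler_rho x t /\ v x t = euler_u x t /\ F x t = euler_E x t.
Proof.
intros sol x t Ht HT.
assert (Hvf := euler_unique_velocity_field T r v F sol).
split; [|now apply Hvf].
assert (D1 := ep_poisson _ _ _ _ _ _ _ _ _ sol x t Ht HT).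
assert (D2 : is_derive (fun y => F y t) x (euler_rho x t - c)).
{ apply (is_derive_ext (fun y => euler_E y t)); [|now apply euler_E_derive_space].
  intros y; symmetry; now apply Hvf. }
assert (D : r x t - c = euler_rho x t - c)
  by (rewrite <- (is_derive_unique _ _ _ D1); now apply is_derive_unique).
lra.
Qed.

(** * Characteristics and exponential decay *)

Lemma flow_characteristics : characteristics euler_u flow.
Proof.
assert (init : forall a, flow a 0 = a).
{ intros a; unfold flow; rewrite !Rmult_0_r, exp_0; field; lra. }
intros a; split; [apply init|split].
- assert (C := is_derive_continuous _ _ _ (flow_derive_time a 0)).
  unfold continuous in C; rewrite init in C.
  eapply filterlim_filter_le_1; [|exact C].
  intros P HP; unfold at_right, within; generalize HP; apply filter_imp; tauto.
- intros t Ht; unfold euler_u; rewrite label_flow by lra; apply flow_derive_time.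
Qed.

Lemma kernel_weight_decay a b t :
  0 <= t ->
  Rabs (exp (- mu2 * t) * a - exp (- mu1 * t) * b) <= (Rabs a + Rabs b) * exp (- mu1 * t).
Proof.
intros Ht.
assert (A := exp_pos (- mu2 * t)); assert (B := kernel_nonneg t Ht).
assert (C : exp (- mu2 * t) <= exp (- mu1 * t)).
{ unfold kernel in B.
  apply (Rmult_le_compat_r (mu2 - mu1)) in B; [|lra].
  unfold Rdiv in B; rewrite Rmult_assoc, Rinv_l in B; lra. }
eapply Rle_trans; [apply Rabs_triang|].
rewrite Rabs_Ropp, !Rabs_mult, !(Rabs_pos_eq (exp _)) by lra.
generalize (Rabs_pos a) (Rabs_pos b); nra.
Qed.

(** As time grows the Jacobian tends to [rho0 a / c], so in [rho - c = (rho0 - c J) / J] the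
    numerator consists of decaying exponentials, while [J] is bounded below uniformly in time. The
    constant depends on the label through [mode'], as [u0'] need not be bounded above. *)
Lemma euler_decay a : exists C, forall t, 0 <= t ->
  Rabs (euler_u (flow a t) t) <= C * exp (- mu1 * t) /\
  Rabs (euler_rho (flow a t) t - c) <= C * exp (- mu1 * t).
Proof.
pose (m := Rmin 1 (rho0 a / c)).
assert (mp : 0 < m) by (apply Rmin_pos; [lra|apply Rdiv_lt_0_compat; auto]).
pose (C1 := (Rabs (mu2 * mode mu1 a) + Rabs (mu1 * mode mu2 a)) * / (mu2 - mu1)).
pose (C2 := (Rabs (c * mode' mu1 a) + Rabs (c * mode' mu2 a)) * / (mu2 - mu1) * / m).
exists (Rmax C1 C2); intros t Ht.
assert (D := exp_pos (- mu1 * t)); assert (J := jacobian_pos a t Ht).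
assert (L := jacobian_lower a t Ht); fold m in L.
assert (d : 0 < / (mu2 - mu1)) by (apply Rinv_0_lt_compat; lra).
split.
- apply Rle_trans with (C1 * exp (- mu1 * t));
    [|apply Rmult_le_compat_r; [lra|apply Rmax_l]].
  unfold euler_u; rewrite label_flow by trivial; unfold velocity, Rdiv.
  rewrite Rabs_mult, (Rabs_pos_eq (/ _)) by lra.
  replace (C1 * exp (- mu1 * t)) with
    ((Rabs (mu2 * mode mu1 a) + Rabs (mu1 * mode mu2 a)) * exp (- mu1 * t)
      * / (mu2 - mu1)) by (unfold C1; ring).
  apply Rmult_le_compat_r; [lra|].
  rewrite (Rmult_comm mu2), (Rmult_comm mu1 (exp _)), !(Rmult_assoc (exp _)).
  now apply kernel_weight_decay.
- apply Rle_trans with (C2 * exp (- mu1 * t));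
    [|apply Rmult_le_compat_r; [lra|apply Rmax_r]].
  unfold euler_rho; rewrite label_flow by trivial.
  replace (rho0 a / jacobian a t - c) with
    ((exp (- mu2 * t) * (c * mode' mu1 a) - exp (- mu1 * t) * (c * mode' mu2 a))
      * / (mu2 - mu1) * / jacobian a t).
  2:{ replace (rho0 a) with (c + c * ((mode' mu1 a - mode' mu2 a) / (mu2 - mu1)))
        by (unfold mode'; field; lra).
      field_simplify_eq; [unfold jacobian; field|]; lra. }
  rewrite !Rabs_mult, (Rabs_pos_eq (/ (_ - _))), (Rabs_pos_eq (/ jacobian _ _))
    by (apply Rlt_le; trivial; now apply Rinv_0_lt_compat).
  replace (C2 * exp (- mu1 * t)) with
    ((Rabs (c * mode' mu1 a) + Rabs (c * mode' mu2 a)) * exp (- mu1 * t)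
      * / (mu2 - mu1) * / m) by (unfold C2; ring).
  apply Rmult_le_compat.
  + apply Rmult_le_pos; [apply Rabs_pos|lra].
  + apply Rlt_le; now apply Rinv_0_lt_compat.
  + apply Rmult_le_compat_r; [lra|now apply kernel_weight_decay].
  + now apply Rinv_le_contravar.
Qed.

(** * Differentiability of the density *)

Variable rho0' : R -> R.
Hypotheses (rho0_derive : forall a, is_derive rho0 a (rho0' a))
  (rho0'_cont : forall a, continuous rho0' a).

Lemma kernel_pos t : 0 < t -> 0 < kernel t.
Proof.
intros Ht; apply Rdiv_lt_0_compat; [|lra].
apply Rlt_0_minus, exp_increasing; nra.
Qed.

Lemma flow_far (A t : R) : 0 <= t -> exists M, forall a, M < Rabs a -> A < Rabs (flow a t).
Proof.
intros Ht; destruct flow_displacement as [K HK]; exists (A + K); intros a Ha.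
assert (B := HK a t Ht).
assert (C := Rabs_triang (flow a t) (a - flow a t)).
replace (flow a t + (a - flow a t)) with a in C by ring.
rewrite (Rabs_minus_sym a) in C; lra.
Qed.

Lemma euler_rho_pos x t : 0 <= t -> 0 < euler_rho x t.
Proof. intros Ht; apply Rdiv_lt_0_compat; [apply rho0_pos|now apply jacobian_pos]. Qed.

Definition slope_of_density (w b r s : R) : R := (r / s - 1 - (1 - w) * (r / c - 1)) / b.

(* Solving [jacobian a t = rho0 a / rho] for u0'. *)
Lemma slope_of_density_eq a t :
  0 < t ->
  u0' a = slope_of_density (exp (- mu1 * t) + mu1 * kernel t) (kernel t)
    (rho0 a) (euler_rho (flow a t) t).
Proof.
intros Ht; assert (J := jacobian_pos a t (Rlt_le _ _ Ht)).
assert (B := kernel_pos t Ht); assert (P := rho0_pos a).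
unfold slope_of_density, euler_rho; rewrite label_flow by lra.
replace (rho0 a / (rho0 a / jacobian a t)) with (jacobian a t) by (field; lra).
rewrite jacobian_kernel; set (w := exp (- mu1 * t) + mu1 * kernel t); field; lra.
Qed.

(** At one positive time [u0'] is an algebraic expression in [rho0] and the density pulled back by
    the flow, both of class C^1. Positivity of the time matters because the kernel, by which one
    divides, vanishes at 0. *)
Lemma initial_slope_regular t (rx : R -> R) :
  0 < t -> (forall x, is_derive (fun y => euler_rho y t) x (rx x)) ->
  (forall x, continuous rx x) ->
  exists u0'', (forall a, is_derive u0' a (u0'' a)) /\ (forall a, continuous u0'' a).
Proof.
intros Ht Hrx Hrxc.
set (w := exp (- mu1 * t) + mu1 * kernel t).
pose (r := fun a => euler_rho (flow a t) t).
assert (rp : forall a, 0 < r a) by (intros; apply euler_rho_pos; lra).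
assert (B := kernel_pos t Ht).
pose (r' := fun a => jacobian a t * rx (flow a t)).
assert (Hr : forall a, is_derive r a (r' a)).
{ intros a; apply (is_derive_comp (fun y => euler_rho y t) (fun a => flow a t)); trivial.
  apply flow_derive_label. }
exists (fun a => ((rho0' a * r a - rho0 a * r' a) / (r a * r a) - (1 - w) * (rho0' a / c))
  / kernel t); split; intros a.
- apply (is_derive_ext (fun a => slope_of_density w (kernel t) (rho0 a) (r a))).
  { intros b; symmetry; now apply slope_of_density_eq. }
  assert (D := Hr a); specialize (rp a); unfold slope_of_density; auto_derive.
  + repeat split; try (eexists; eauto; fail); lra.
  + rewrite (Derive_eta _ _ _ (rho0_derive a)), (Derive_eta _ _ _ D); field; lra.
- assert (rc := is_derive_continuous _ _ _ (Hr a)).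
  assert (r0c := is_derive_continuous _ _ _ (rho0_derive a)).
  assert (r'c : continuous r' a).
  { apply (continuous_Rmult (fun a => jacobian a t) (fun a => rx (flow a t))).
    - apply (continuous_comp_2 (fun a => a) (fun _ => t) jacobian);
        [apply continuous_id|apply continuous_const|apply jacobian_continuous].
    - apply continuous_real_comp; trivial.
      exact (is_derive_continuous _ _ _ (flow_derive_label a t)). }
  specialize (rp a).
  continuity_arith; trivial; nra.
Qed.

(** The same algebraic expression, passed to the limit: it vanishes when both densities equal [c],
    and the flow carries far labels to far points. *)
Lemma initial_slope_far t :
  0 < t -> lim_both (fun x => euler_rho x t) c -> lim_both u0' 0.
Proof.
intros Ht Hlim; assert (B := kernel_pos t Ht).
set (w := exp (- mu1 * t) + mu1 * kernel t).
assert (L : lim_both (fun a => slope_of_density w (kernel t) (rho0 a) (euler_rho (flow a t) t))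
  (slope_of_density w (kernel t) c c)).
{ apply (lim_both_comp2 (slope_of_density w (kernel t))); trivial.
  - apply (lim_both_comp_proper (fun x => euler_rho x t)); trivial.
    intros A; apply flow_far; lra.
  - unfold slope_of_density; continuity_arith; simpl; lra. }
replace (slope_of_density w (kernel t) c c) with 0 in L
  by (unfold slope_of_density; field; lra).
apply lim_both_epsilon; intros eta He.
destruct (proj1 (lim_both_epsilon _ _) L eta He) as [M HM]; exists M; intros a Ha.
rewrite (slope_of_density_eq a t Ht); now apply HM.
Qed.

Variable u0'' : R -> R.
Hypotheses (u0'_derive : forall a, is_derive u0' a (u0'' a))
  (u0''_cont : forall a, continuous u0'' a)
  (u0'_far : lim_both u0' 0).

Definition jacobian' (a t : R) : R :=
  (1 - (exp (- mu1 * t) + mu1 * kernel t)) * (rho0' a / c) + kernel t * u0'' a.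

Lemma jacobian_derive_label a t : is_derive (fun b => jacobian b t) a (jacobian' a t).
Proof.
apply (is_derive_ext (fun b => 1 + (1 - (exp (- mu1 * t) + mu1 * kernel t)) * (rho0 b / c - 1)
    + kernel t * u0' b)).
{ intros b; symmetry; apply jacobian_kernel. }
unfold jacobian'; auto_derive.
- repeat split; trivial; eexists; eauto.
- rewrite (Derive_eta _ _ _ (rho0_derive a)), (Derive_eta _ _ _ (u0'_derive a)).
  unfold Rdiv; ring.
Qed.

Lemma kernel_continuous (p : R * R) : continuous (fun q => kernel (snd q)) p.
Proof. unfold kernel; continuity_arith; lra. Qed.

Lemma jacobian'_continuous (p : R * R) :
  continuous (fun q : R * R => jacobian' (fst q) (snd q)) p.
Proof.
assert (K := kernel_continuous p).
unfold jacobian'; continuity_arith; trivial; try lra;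
  apply continuous_real_comp; trivial; apply continuous_fst.
Qed.

Definition density (a t : R) : R := rho0 a / jacobian a t.
Definition density_a (a t : R) : R :=
  (rho0' a * jacobian a t - rho0 a * jacobian' a t) / (jacobian a t * jacobian a t).
Definition density_t (a t : R) : R :=
  - (rho0 a * velocity' a t) / (jacobian a t * jacobian a t).

Lemma density_a_continuous a t :
  0 <= t -> continuous (fun p : R * R => density_a (fst p) (snd p)) (a, t).
Proof.
intros Ht; assert (J := jacobian_pos a t Ht); unfold density_a.
assert (Jc := jacobian_continuous (a, t)); assert (J'c := jacobian'_continuous (a, t)).
continuity_arith; trivial; simpl; try nra;
  apply continuous_real_comp; trivial; apply continuous_fst.
Qed.

Lemma density_t_continuous a t :
  0 <= t -> continuous (fun p : R * R => density_t (fst p) (snd p)) (a, t).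
Proof.
intros Ht; assert (J := jacobian_pos a t Ht); unfold density_t.
assert (Jc := jacobian_continuous (a, t)); assert (Vc := velocity'_continuous (a, t)).
continuity_arith; trivial; simpl; try nra;
  apply continuous_real_comp; trivial; apply continuous_fst.
Qed.

Lemma density_differentiable a t :
  0 <= t -> differentiable_pt_lim density a t (density_a a t) (density_t a t).
Proof.
intros Ht; assert (J := jacobian_pos a t Ht).
apply differentiable_pt_lim_partials.
(* At [t = 0] the neighbourhood contains negative times, which the threshold bound does not reach,
   so positivity nearby is taken from continuity. *)
- assert (Jloc : locally (a, t) (fun p => 0 < jacobian (fst p) (snd p)))
    by exact (jacobian_continuous (a, t) _ (locally_positive _ J)).
  revert Jloc; apply filter_imp; intros [b s]; simpl; intros Jb.
  assert (D := jacobian_derive_label b s); unfold density, density_a; auto_derive.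
  + split; [now eexists; apply rho0_derive|split; [now eexists; exact D|]].
    split; [lra|trivial].
  + rewrite (Derive_eta _ _ _ (rho0_derive b)), (Derive_eta (fun b => jacobian b s) _ _ D).
    field; lra.
- assert (D := jacobian_derive_time a t); unfold density, density_t; auto_derive.
  + split; [now eexists; exact D|split; [lra|trivial]].
  + rewrite (Derive_eta (fun s => jacobian a s) _ _ D); field; lra.
- now apply density_a_continuous.
Qed.

Lemma euler_rho_derive_space x t :
  0 <= t -> is_derive (fun y => euler_rho y t) x
    (density_a (label x t) t / jacobian (label x t) t).
Proof.
intros Ht; apply (label_comp_derive_space density) with (ht := density_t (label x t) t);
  trivial; now apply density_differentiable.
Qed.

Lemma euler_rho_derive_time x t :
  0 < t -> is_derive (fun s => euler_rho x s) t
    (density_t (label x t) t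
     - euler_u x t * (density_a (label x t) t / jacobian (label x t) t)).
Proof.
intros Ht; apply (label_comp_derive_time density); trivial.
apply density_differentiable; lra.
Qed.

Lemma euler_rho_C1 T : C1_on_strip T euler_rho.
Proof.
split; [apply euler_rho_continuous|].
exists (fun x t => density_a (label x t) t / jacobian (label x t) t).
exists (fun x t => density_t (label x t) t
     - euler_u x t * (density_a (label x t) t / jacobian (label x t) t)).
assert (C : continuous_on_strip T
  (fun x t => density_a (label x t) t / jacobian (label x t) t)).
{ apply (continuous_on_strip_label T (fun a t => density_a a t / jacobian a t)).
  intros a t Ht.
  apply (continuous_Rdiv (fun p => density_a (fst p) (snd p))
    (fun p => jacobian (fst p) (snd p))).
  - now apply density_a_continuous.
  - apply jacobian_continuous.
  - simpl; generalize (jacobian_pos a t Ht); lra. }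
split; [exact C|split; [|split]].
- apply continuous_on_strip_minus.
  + apply continuous_on_strip_label; intros; now apply density_t_continuous.
  + apply continuous_on_strip_mult; [apply euler_u_continuous|exact C].
- intros; now apply euler_rho_derive_space.
- intros; now apply euler_rho_derive_time.
Qed.

(** Along characteristics the density changes at the rate [- rho J_t / J], and [J_t / J] is [u_x];
    the terms in [rho_x] cancel. *)
Lemma euler_mass_pointwise x t :
  0 < t -> Derive (fun s => euler_rho x s) t
    + Derive (fun y => euler_rho y t * euler_u y t) x = 0.
Proof.
intros Ht; assert (J := jacobian_pos (label x t) t (Rlt_le _ _ Ht)).
assert (D1 := euler_rho_derive_space x t (Rlt_le _ _ Ht)).
assert (D2 := euler_u_derive_space x t (Rlt_le _ _ Ht)).
rewrite (Derive_eta _ _ _ (euler_rho_derive_time x t Ht)).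
rewrite (Derive_eta (fun y => euler_rho y t * euler_u y t) x
  (density_a (label x t) t / jacobian (label x t) t * euler_u x t
   + euler_rho x t * (velocity' (label x t) t / jacobian (label x t) t))).
- unfold density_t, euler_rho; field; lra.
- auto_derive.
  + split; [now eexists; exact D1|split; [now eexists; exact D2|trivial]].
  + rewrite (Derive_eta (fun y => euler_rho y t) _ _ D1),
      (Derive_eta (fun y => euler_u y t) _ _ D2); ring.
Qed.

(** At a fixed time the Jacobian tends to 1, since [rho0] tends to [c] and [u0'] to 0, and labels go
    to infinity with [x]. *)
Lemma euler_rho_far t : 0 <= t -> lim_both (fun x => euler_rho x t) c.
Proof.
intros Ht; set (w := exp (- mu1 * t) + mu1 * kernel t).
pose (h := fun r v => r / (1 + (1 - w) * (r / c - 1) + kernel t * v)).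
assert (L : lim_both (fun a => h (rho0 a) (u0' a)) (h c 0)).
{ apply lim_both_comp2; trivial.
  unfold h; continuity_arith; simpl; try lra.
  replace (_ + _) with 1 by (field; lra); lra. }
replace (h c 0) with c in L
  by (unfold h; replace (1 + _ + _) with 1 by (field; lra); field).
apply (lim_both_comp_proper (fun a => density a t) (fun x => label x t)).
- apply lim_both_epsilon; intros eta He.
  destruct (proj1 (lim_both_epsilon _ _) L eta He) as [M HM]; exists M; intros a Ha.
  unfold density; rewrite jacobian_kernel; now apply HM.
- intros A; destruct (label_far A) as [M HM]; exists M; auto.
Qed.

Lemma euler_classical : classical_solution k c eps rho0 u0 p_infty euler_rho euler_u euler_E.
Proof.
split.
- apply euler_ep_solution.
- apply euler_rho_C1.
- intros; now apply euler_mass_pointwise.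
- intros; now apply euler_rho_far.
Qed.

End LagrangianFlow.

(** * Assembly of the theorem *)

Lemma continuous_antiderivative (f : R -> R) :
  (forall x, continuous f x) -> exists g, forall x, is_derive g x (f x).
Proof.
intros Hf; exists (fun x => RInt f 0 x); intros x.
apply (is_derive_RInt f _ 0); trivial.
apply filter_forall; intros b; apply (@RInt_correct R_CompleteNormedModule).
apply (@ex_RInt_continuous R_CompleteNormedModule); auto.
Qed.

Theorem theorem3p4 (k c eps : R) (rho0 u0 : R -> R)
  (hk : 0 < k) (hc : 0 < c)
  (heps : 0 < eps) (hstrong : eps < 1 / (2 * sqrt (c * k)))
  (hrho0 : class_C1 rho0) (hu0 : class_C1 u0)
  (hrho0_pos : forall x, 0 < rho0 x)
  (hrho0_far : lim_both rho0 c) (hu0_far : lim_both u0 0)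
  (hneutral : is_RInt_gen (fun x => rho0 x - c)
                (Rbar_locally m_infty) (Rbar_locally p_infty) 0)
  (hthreshold : forall alpha,
     Derive u0 alpha >
       Rmin 0 (- (1 - rho0 alpha / c) *
                 (sqrt (1 / (4 * eps ^ 2) - c * k) + 1 / (2 * eps)))) :
  exists rho u E X : R -> R -> R,
    (* a solution for all time, the unique one on every time interval *)
    ep_solution k c eps rho0 u0 p_infty rho u E /\
    (forall (T : Rbar) (r v F : R -> R -> R),
       ep_solution k c eps rho0 u0 T r v F ->
       forall x t, 0 <= t -> Rbar_lt t T ->
         r x t = rho x t /\ v x t = u x t /\ F x t = E x t) /\
    (* if it is classical for a short time, it is so for all time *)
    (forall T : Rbar, Rbar_lt 0 T ->
       classical_solution k c eps rho0 u0 T rho u E ->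
       classical_solution k c eps rho0 u0 p_infty rho u E) /\
    (* which is the case for the following data *)
    (class_C1 (Derive u0) -> lim_both (Derive u0) 0 ->
       classical_solution k c eps rho0 u0 p_infty rho u E) /\
    (* exponential decay along characteristics *)
    characteristics u X /\
    (exists lambda : R, 0 < lambda /\
       forall alpha, exists C : R, forall t, 0 <= t ->
         Rabs (u (X alpha t) t) <= C * exp (- lambda * t) /\
         Rabs (rho (X alpha t) t - c) <= C * exp (- lambda * t)).
Proof.
pose (h := 1 / (2 * eps)).
assert (h_pos : 0 < h) by (apply Rdiv_lt_0_compat; lra).
set (s := sqrt (1 / (4 * eps ^ 2) - c * k)) in hthreshold.
assert (ck_pos : 0 < c * k) by now apply Rmult_lt_0_compat.
assert (disc : 1 / (4 * eps ^ 2) - c * k = h * h - c * k) by (unfold h; field; lra).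
(* Strong relaxation says [sqrt (c * k) < h]. The discriminant is then positive, so [h - s] and
   [h + s] are real and distinct, and [s < h] keeps the smaller one positive. *)
assert (disc_pos : c * k < h * h).
{ set (q := sqrt (c * k)) in *.
  assert (q_pos : 0 < q) by now apply sqrt_lt_R0.
  rewrite <- (sqrt_sqrt (c * k)) by lra; fold q.
  assert (q < h).
  { apply (Rmult_lt_reg_r (2 * eps)); [lra|].
    unfold h; replace (1 / (2 * eps) * (2 * eps)) with 1 by (field; lra).
    apply (Rmult_lt_compat_r (2 * q)) in hstrong; [|lra].
    replace (1 / (2 * q) * (2 * q)) with 1 in hstrong by (field; lra); lra. }
  nra. }
assert (s_sqr : s * s = h * h - c * k).
{ unfold s; rewrite disc; apply sqrt_sqrt; lra. }
assert (s_pos : 0 < s) by (unfold s; rewrite disc; apply sqrt_lt_R0; lra).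
pose (mu1 := h - s); pose (mu2 := h + s).
assert (mu1_pos : 0 < mu1) by (unfold mu1; nra).
assert (mu1_lt_mu2 : mu1 < mu2) by (unfold mu1, mu2; lra).
assert (mu_prod : mu1 * mu2 = c * k) by (unfold mu1, mu2; lra).
assert (mu_sum : mu1 + mu2 = / eps) by (unfold mu1, mu2, h; field; lra).
(* A number above a minimum exceeds one of the two entries, and the bracket in the hypothesis is
   [mu2]. *)
assert (threshold : forall a,
  0 < Derive u0 a \/ - (1 - rho0 a / c) * mu2 < Derive u0 a).
{ intros a; generalize (hthreshold a); unfold mu2, h; rewrite (Rplus_comm _ s).
  unfold Rmin; destruct Rle_dec; intros; [left|right]; lra. }
assert (rho0_derive : forall a, is_derive rho0 a (Derive rho0 a)).
{ intros a; apply Derive_correct, hrho0. }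
assert (rho0'_cont : forall a, continuous (Derive rho0) a) by apply hrho0.
assert (u0_derive : forall a, is_derive u0 a (Derive u0 a)).
{ intros a; apply Derive_correct, hu0. }
assert (u0'_cont : forall a, continuous (Derive u0) a) by apply hu0.
assert (rho0_cont : forall a, continuous rho0 a).
{ intros a; exact (is_derive_continuous _ _ _ (rho0_derive a)). }
assert (f_cont : forall x, continuous (fun x => rho0 x - c) x).
{ intros x; apply (continuous_Rminus rho0 (fun _ => c)); [trivial|apply continuous_const]. }
destruct (continuous_antiderivative _ f_cont) as [g g_derive].
destruct (is_RInt_gen_antiderivative_lim_both _ g g_derive f_cont hneutral) as [L g_far].
(* Neutrality gives the antiderivative one common limit at both ends; subtracting it yields the
   initial field. *)
pose (E0 := fun x => g x - L).
assert (E0_derive : forall a, is_derive E0 a (rho0 a - c)).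
{ intros a; replace (rho0 a - c) with (rho0 a - c - 0) by ring.
  apply (is_derive_minus g (fun _ => L)); [apply g_derive|apply (is_derive_const L)]. }
assert (E0_far : lim_both E0 0).
{ apply lim_both_epsilon; intros eta He.
  destruct (proj1 (lim_both_epsilon _ _) g_far eta He) as [M HM].
  exists M; intros x Hx; unfold E0; rewrite Rminus_0_r; auto. }
destruct (flow_label_exists c mu1 mu2 rho0 u0 (Derive u0) E0) as [label Hlabel]; trivial.
assert (classical : forall u0'', (forall a, is_derive (Derive u0) a (u0'' a)) ->
  (forall a, continuous u0'' a) -> lim_both (Derive u0) 0 ->
  classical_solution k c eps rho0 u0 p_infty (euler_rho c mu1 mu2 rho0 (Derive u0) label)
    (euler_u c mu1 mu2 u0 E0 label) (euler_E c mu1 mu2 u0 E0 label)).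
{ intros; eapply euler_classical; eauto. }
exists (euler_rho c mu1 mu2 rho0 (Derive u0) label), (euler_u c mu1 mu2 u0 E0 label),
  (euler_E c mu1 mu2 u0 E0 label), (flow c mu1 mu2 u0 E0).
split; [|split; [|split; [|split; [|split]]]].
- eapply euler_ep_solution; eauto.
- intros T r v F; eapply euler_unique; eauto.
- intros T T_pos [_ [_ (rx & rt & rx_cont & _ & rx_derive & _)] _ rho_far].
  (* Any positive time before [T] serves: the density there yields a C^1 slope [u0'] that vanishes
     at infinity, which is all that classical regularity for all time requires. *)
  destruct (Rbar_lt_room T 0 T_pos) as [t [t_pos tT]]; rewrite Rplus_0_l in tT.
  destruct (initial_slope_regular c mu1 mu2 rho0 u0 (Derive u0) E0) with
    (label := label) (rho0' := Derive rho0) (t := t) (rx := fun x => rx x t)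
    as (u0'' & D & C); trivial.
  { intros x; apply rx_derive; trivial; lra. }
  { intros x; apply (continuous_on_strip_slice T); trivial; lra. }
  apply (classical u0''); trivial.
  apply (initial_slope_far c mu1 mu2 rho0 u0 (Derive u0) E0) with (label := label) (t := t);
    trivial.
  apply rho_far; trivial; lra.
- intros u0'_C1 u0'_far; apply (classical (Derive (Derive u0))); trivial; intros a.
  + apply Derive_correct, u0'_C1.
  + apply u0'_C1.
- eapply flow_characteristics; eauto.
- exists mu1; split; trivial; eapply euler_decay; eauto.
Qed.
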